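(* Let $B_0$ be a skew-symmetric $n\times n$ integer matrix such that $\Gamma(B_0)$ is acyclic, let $\mathbf{c}_0$ be the tuple of standard basis vectors of $\mathbb{Z}^n$, and let $A_0$ be the generalized Cartan matrix associated to $B_0$. Let $\Sigma_t=(\mathbf{c},B)$ be the $Y$-seed at a vertex $t\in\mathbb{T}_n$ in the $Y$-seed pattern with initial seed $(\mathbf{c}_0,B_0)$, let $t'$ be the vertex joined to $t$ by the edge labeled $k$, and let $\Sigma_{t'}=\mu_k(\mathbf{c},B)=(\mathbf{c}',B')$. Put $A_t=(\mathbf{c}_i^{T}A_0\mathbf{c}_j)_{i,j}$, $A_{t'}=({\mathbf{c}'_i}^{T}A_0\mathbf{c}'_j)_{i,j}$ and $\epsilon=\mathrm{sgn}(\mathbf{c}_k)$. Then: (1) $\mathbf{c}'=\mu_k^{\epsilon}(\mathbf{c})$; (2) $A_{t'}=\mu_k^{\epsilon}(A_t)$; (3) if $\mathbf{c}'_i\neq\mathbf{c}_i$, then $\mathbf{c}'_i=s_{\mathbf{c}_k}(\mathbf{c}_i)$, where $s_{\mathbf{c}_k}$ is the reflection with respect to the real root $\mathbf{c}_k$ and $\mathbb{Z}^n$ is identified with the root lattice.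
   Context: Notation: $[b]_+=\max(b,0)$; $\mathrm{sgn}(x)\in\{-1,0,1\}$ for a real number $x$; vectors of $\mathbb{Z}^n$ are column vectors and $^{T}$ is transpose. $Y$-seeds. A $Y$-seed is a pair $(\mathbf{c},B)$ where $B$ is an $n\times n$ skew-symmetrizable integer matrix (here always skew-symmetric) and $\mathbf{c}=(\mathbf{c}_1,\dots,\mathbf{c}_n)$ is a tuple of non-zero vectors $\mathbf{c}_i\in\mathbb{Z}^n$, each having either all entries nonnegative (then $\mathrm{sgn}(\mathbf{c}_i)=+1$) or all entries nonpositive (then $\mathrm{sgn}(\mathbf{c}_i)=-1$). For $k\in\{1,\dots,n\}$, the mutation $\mu_k(\mathbf{c},B)=(\mathbf{c}',B')$ is defined by: $B'_{ij}=-B_{ij}$ if $i=k$ or $j=k$, and $B'_{ij}=B_{ij}+[B_{ik}]_+[B_{kj}]_+-[-B_{ik}]_+[-B_{kj}]_+$ otherwise; $\mathbf{c}'_k=-\mathbf{c}_k$ and $\mathbf{c}'_i=\mathbf{c}_i+[\mathrm{sgn}(\mathbf{c}_k)B_{k,i}]_+\mathbf{c}_k$ for $i\ne k$. $Y$-seed pattern. Let $\mathbb{T}_n$ be the $n$-regular tree with edges labeled by $1,\dots,n$ so that the $n$ edges at each vertex have different labels. A $Y$-seed pattern assigns a $Y$-seed to each vertex of $\mathbb{T}_n$ so that the seeds at the ends of an edge labeled $k$ are obtained from each other by $\mu_k$. It is a known theorem that for $B_0$ skew-symmetric with $\Gamma(B_0)$ acyclic and $\mathbf{c}_0$ the standard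 basis, the initial seed $(\mathbf{c}_0,B_0)$ determines a unique $Y$-seed pattern, and each vector $\mathbf{c}_i$ of each of its seeds is the coordinate vector of a real root, with respect to the basis of simple roots, of the root system of $A_0$. Diagram. $\Gamma(B)$ is the directed graph on $1,\dots,n$ with a directed edge from $i$ to $j$ if and only if $B_{j,i}>0$; it is acyclic if it has no oriented cycles. Associated generalized Cartan matrix of $B_0$: $(A_0)_{i,i}=2$ and $(A_0)_{i,j}=-|(B_0)_{i,j}|$ for $i\ne j$. Its root lattice is spanned by simple roots $\alpha_1,\dots,\alpha_n$ and is identified with $\mathbb{Z}^n$ by sending $\alpha_i$ to the $i$-th standard basis vector. The simple reflections are $s_i(\alpha_j)=\alpha_j-(A_0)_{i,j}\alpha_i$; real roots are the vectors obtained from simple roots by sequences of simple reflections. The reflection with respect to a real root $\beta$ is $s_\beta(v)=v-(\beta^{T}A_0v)\beta$. Mutation of companions. A quasi-Cartan matrix is a symmetrizable matrix all of whose diagonal entries equal $2$; a quasi-Cartan companion of $B$ is a quasi-Cartan matrix $A$ with $|A_{i,j}|=|B_{i,j}|$ for $i\neq j$. In the present setting $A_t$ is a quasi-Cartan companion of $B$. For a quasi-Cartan companion $A$ of $B$, an index $k$ and a sign $\epsilon=\pm1$, the $\epsilon$-mutation of $A$ at $k$ is the quasi-Cartan matrix $\mu_k^{\epsilon}(A)=A'$ such that for all $i,j\ne k$: $A'_{i,k}=\epsilon\,\mathrm{sgn}(B_{k,i})A_{i,k}$, $A'_{k,j}=\epsilon\,\mathrm{sgn}(B_{k,j})A_{k,j}$,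 $A'_{i,j}=A_{i,j}-\mathrm{sgn}(A_{i,k}A_{k,j})[B_{i,k}B_{k,j}]_+$ (and $A'_{k,k}=2$). Correspondingly, for a basis $(e_1,\dots,e_n)$ of $\mathbb{Z}^n$ for which $A$ is the Gram matrix of a symmetric bilinear form, $\mu_k^{\epsilon}(e_1,\dots,e_n)=(e'_1,\dots,e'_n)$ where $e'_k=-e_k$; $e'_i=e_i-A_{k,i}e_k$ if $i\neq k$ and $\epsilon B_{k,i}>0$; and $e'_i=e_i$ otherwise. In (1), $\mu_k^\epsilon(\mathbf{c})$ is this operation applied to the basis $\mathbf{c}$ with $A=A_t$ (the Gram matrix of $\mathbf{c}$ for the form $(u,v)\mapsto u^{T}A_0v$). *)

(* Defs.v *)
From mathcomp Require Import all_boot all_order all_algebra.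

Set Implicit Arguments.
Unset Strict Implicit.
Unset Printing Implicit Defensive.

Import Order.TTheory GRing.Theory Num.Theory.
Local Open Scope ring_scope.

Definition pos_part (b : int) : int := Num.max b 0.

Definition skew_symmetric (n : nat) (B : 'M[int]_n) : Prop := B^T = - B.

Definition skew_symmetrizable (n : nat) (B : 'M[int]_n) : Prop :=
  exists d : 'I_n -> int,
    (forall i, 0 < d i) /\ (forall i j, d i * B i j = - (d j * B j i)).

(* The arrows of Gamma(B): i -> j iff B_{j,i} > 0 (note the transposition). *)
Definition diagram (n : nat) (B : 'M[int]_n) : rel 'I_n :=
  fun i j => 0 < B j i.

Definition acyclic_diagram (n : nat) (B : 'M[int]_n) : Prop :=
  forall p : seq 'I_n, path.cycle (diagram B) p -> p = [::].

Definition nonneg_vec (n : nat) (v : 'cV[int]_n) : bool :=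
  [forall i, 0 <= v i 0].

Definition nonpos_vec (n : nat) (v : 'cV[int]_n) : bool :=
  [forall i, v i 0 <= 0].

(* Only meaningful on nonzero sign-coherent vectors; 0 is a default value for
   vectors having entries of both signs. *)
Definition vec_sgn (n : nat) (v : 'cV[int]_n) : int :=
  if nonneg_vec v then 1 else if nonpos_vec v then -1 else 0.

(* Pairs (c, B); those that are Y-seeds are singled out by [is_Yseed], because
   mutation does not preserve sign-coherence for arbitrary pairs. *)
Definition preseed (n : nat) : Type :=
  ({ffun 'I_n -> 'cV[int]_n} * 'M[int]_n)%type.

Definition is_Yseed (n : nat) (s : preseed n) : Prop :=
  skew_symmetrizable s.2 /\
  (forall i, s.1 i <> 0 /\ (nonneg_vec (s.1 i) || nonpos_vec (s.1 i))).

Definition mutate_matrix (n : nat) (k : 'I_n) (B : 'M[int]_n) : 'M[int]_n :=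
  \matrix_(i, j)
    if (i == k) || (j == k) then - B i j
    else B i j + pos_part (B i k) * pos_part (B k j)
               - pos_part (- B i k) * pos_part (- B k j).

Definition mutate_seed (n : nat) (k : 'I_n) (s : preseed n) : preseed n :=
  let c := s.1 in let B := s.2 in
  ([ffun i => if i == k then - c k
              else c i + pos_part (vec_sgn (c k) * B k i) *: c k],
   mutate_matrix k B).

(* The n-regular tree with edges labeled by 'I_n: a vertex is the word of
   labels, last edge first, along the path reaching it from a fixed root [::];
   such words are exactly those without two equal consecutive letters. *)
Definition tree (n : nat) : Type :=
  {w : seq 'I_n | sorted (fun i j => i != j) w}.

Definition tree_edge (n : nat) (k : 'I_n) (t t' : tree n) : Prop :=
  val t' = k :: val t \/ val t = k :: val t'.

(* As [tree_edge k] is symmetric, each of the two seeds at the ends of an edge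
   is required to be the mutation of the other. *)
Definition Yseed_pattern (n : nat) (S : tree n -> preseed n) : Prop :=
  (forall t, is_Yseed (S t)) /\
  (forall k t t', tree_edge k t t' -> S t' = mutate_seed k (S t)).

Definition simple_root (n : nat) (i : 'I_n) : 'cV[int]_n := delta_mx i 0.

Definition std_basis (n : nat) : {ffun 'I_n -> 'cV[int]_n} :=
  [ffun i => simple_root i].

Definition gen_cartan (n : nat) (B : 'M[int]_n) : 'M[int]_n :=
  \matrix_(i, j) if i == j then 2 else - `|B i j|.

Definition form (n : nat) (A : 'M[int]_n) (u v : 'cV[int]_n) : int :=
  (u^T *m A *m v) 0 0.

Definition gram (n : nat) (A : 'M[int]_n) (c : {ffun 'I_n -> 'cV[int]_n}) :
    'M[int]_n :=
  \matrix_(i, j) form A (c i) (c j).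

(* Linear extension of alpha_j |-> alpha_j - A_{i,j} alpha_i. *)
Definition simple_reflection (n : nat) (A : 'M[int]_n) (i : 'I_n)
    (v : 'cV[int]_n) : 'cV[int]_n :=
  v - (A *m v) i 0 *: simple_root i.

Inductive real_root (n : nat) (A : 'M[int]_n) : 'cV[int]_n -> Prop :=
| real_root_simple (i : 'I_n) : real_root A (simple_root i)
| real_root_reflection (i : 'I_n) (v : 'cV[int]_n) :
    real_root A v -> real_root A (simple_reflection A i v).

Definition reflection (n : nat) (A : 'M[int]_n) (b v : 'cV[int]_n) :
    'cV[int]_n :=
  v - form A b v *: b.

(* The eps-mutation at k of a quasi-Cartan companion A of B. *)
Definition mutate_companion (n : nat) (eps : int) (k : 'I_n)
    (B A : 'M[int]_n) : 'M[int]_n :=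
  \matrix_(i, j)
    if (i == k) && (j == k) then 2
    else if j == k then eps * Num.sg (B k i) * A i k
    else if i == k then eps * Num.sg (B k j) * A k j
    else A i j - Num.sg (A i k * A k j) * pos_part (B i k * B k j).

(* The eps-mutation at k of a basis e whose Gram matrix is the companion A of
   B. *)
Definition mutate_basis (n : nat) (eps : int) (k : 'I_n) (B A : 'M[int]_n)
    (e : {ffun 'I_n -> 'cV[int]_n}) : {ffun 'I_n -> 'cV[int]_n} :=
  [ffun i => if i == k then - e k
             else if 0 < eps * B k i then e i - A k i *: e k
             else e i].

(* Main.v *)
(* Let Q be the quiver with [- B0 i j] arrows from i to j whenever this number is
   positive, and let E be its Euler form, so that A0 = E + E^T and B0 = E - E^T.
   To each seed of the pattern one attaches bricks X_1, ..., X_n of the derived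
   category of Q whose classes are the c-vectors: a representation if c_i is
   positive, a representation shifted by one if c_i is negative.  They form a
   simple-minded collection: H^m(X_i, X_j) = 0 for m < 0, and for m = 0 and i <> j;
   moreover E(c_i, c_i) = 1 and E(c_i, c_j) = 0 unless i = j or i precedes j in a
   suitable order.  Mutation at a positive k replaces X_k by its shift and every
   other X_i by its universal extension by X_k; a negative k is the dual case.  A
   brick over a hereditary algebra lives in a single degree, so the new objects are
   again representations up to shift, and the collection is preserved.  Hence
   E(c_i, c_j) <= 0 for c-vectors of the same sign, E(c_i, c_j) = 0 for c_i positive
   and c_j negative, and E(c_i, c_j) E(c_j, c_i) = 0 for i <> j; the theorem follows
   by computing with A_t = E_t + E_t^T and B_t = E_t - E_t^T. *)

From HB Require Import structures.
From mathcomp Require Import all_boot all_order all_algebra.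
From mathcomp Require Import zify ring.
Require Import Defs.

Set Implicit Arguments.
Unset Strict Implicit.
Unset Printing Implicit Defensive.

Import Order.TTheory GRing.Theory Num.Theory.
Local Open Scope ring_scope.

(** No modules or resolutions are used. The span of the vertices and arrows of Q, with arrows in
    degree 1 and all products of two arrows zero, is the Ext-algebra of the simple representations.
    A twisted complex over it records a complex of representations in a homogeneous basis, and the
    vanishing of these products reflects that Q is hereditary. Simple-mindedness alone does not give
    E(c_i, c_j) E(c_j, c_i) = 0, since extensions might exist in both directions. The invariant
    therefore carries a ranking that makes E triangular. Rebuilding this ranking after a mutation is
    the delicate combinatorial step; it needs to know which negative objects become positive. The
    ranking also yields E(c'_i, c'_i) = 1, from which rigidity is read off. The universal extension
    is not built from a basis of H^1(X_i, X_k) but by attaching X_k along one class at a time until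
    none is left. The number h of copies is found only at the end: the result Y has no cohomology
    towards X_k, so 0 = E(c_i, c_k) + h when h > 0. *)

Lemma addff (V : lmodType 'F_2) (x : V) : x + x = 0.
Proof.
rewrite -{1 2}[x]scale1r -scalerDl.
suff -> : (1 + 1 : 'F_2) = 0 by rewrite scale0r.
exact/eqP.
Qed.

Lemma addfK (V : lmodType 'F_2) (x y : V) : x + y + y = x.
Proof. by rewrite -addrA addff addr0. Qed.

Lemma addKf (V : lmodType 'F_2) (x y : V) : y + (y + x) = x.
Proof. by rewrite addrA addff add0r. Qed.

Lemma F2_neq0 (x : 'F_2) : x != 0 -> x = 1.
Proof. by case: x => [[|[|//]]] // i _; apply/val_inj. Qed.

(** * Complexes of quiver representations over F_2 *)

Record quiver (n : nat) := Quiver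
  { arrow : finType; src : arrow -> 'I_n; tgt : arrow -> 'I_n }.

Definition opq n (Q : quiver n) := Quiver (@tgt n Q) (@src n Q).

(* Matrices with entries in the square-zero extension of F_2 by the arrows: the index
   [None] gives the scalar part and [Some a] the coefficient of the arrow [a].
   Working over F_2 removes all signs from the homological algebra. *)
Notation mor A T T' := {ffun (T * T' * option A)%type -> ('F_2)^o}.

Section Composition.
Variable A : finType.
Implicit Types T : finType.

Definition mcomp (T T' T'' : finType) (f : mor A T T') (g : mor A T' T'') :
    mor A T T'' :=
  [ffun t => \sum_y f (t.1.1, y, None) * g (y, t.1.2, t.2)
     + (if t.2 is Some _ then \sum_y f (t.1.1, y, t.2) * g (y, t.1.2, None)
        else 0)].

Definition lift0 (T T' : finType) (M : T -> T' -> 'F_2) : mor A T T' :=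
  [ffun t => if t.2 is Some _ then 0 else M t.1.1 t.1.2].

Definition idm (T : finType) : mor A T T := lift0 (fun x y => (x == y)%:R).

Local Notation "f ** g" := (mcomp f g) (at level 40, left associativity).

Lemma mcompA T0 T1 T2 T3 (f : mor A T0 T1) (g : mor A T1 T2) (h : mor A T2 T3) :
  f ** (g ** h) = f ** g ** h.
Proof.
have aux (F : T0 -> T1 -> 'F_2) (G : T1 -> T2 -> 'F_2) (H : T2 -> T3 -> 'F_2) x z :
    \sum_y F x y * (\sum_w G y w * H w z) = \sum_w (\sum_y F x y * G y w) * H w z.
  under eq_bigr do rewrite mulr_sumr.
  rewrite exchange_big /=; apply: eq_bigr => w _.
  by rewrite mulr_suml; apply: eq_bigr => y _; rewrite mulrA.
apply/ffunP => -[[x z] [a|]]; rewrite !ffunE /=; last first.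
  rewrite !addr0.
  under eq_bigr do rewrite ffunE /= addr0.
  under [RHS]eq_bigr do rewrite ffunE /= addr0.
  exact: (aux (fun x y => f (x, y, None)) (fun x y => g (x, y, None))
              (fun x y => h (x, y, None))).
have -> : \sum_y f (x, y, None) * (g ** h) (y, z, Some a) =
   \sum_y f (x, y, None) * (\sum_w g (y, w, None) * h (w, z, Some a))
   + \sum_y f (x, y, None) * (\sum_w g (y, w, Some a) * h (w, z, None)).
  by rewrite -big_split /=; apply: eq_bigr => y _; rewrite ffunE /= mulrDr.
have -> : \sum_y (f ** g) (x, y, Some a) * h (y, z, None) =
   \sum_w (\sum_y f (x, y, None) * g (y, w, Some a)) * h (w, z, None)
   + \sum_w (\sum_y f (x, y, Some a) * g (y, w, None)) * h (w, z, None).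
  by rewrite -big_split /=; apply: eq_bigr => y _; rewrite ffunE /= mulrDl.
rewrite (aux (fun x y => f (x, y, None)) (fun x y => g (x, y, None))
             (fun x y => h (x, y, Some a))).
rewrite (aux (fun x y => f (x, y, None)) (fun x y => g (x, y, Some a))
             (fun x y => h (x, y, None))).
rewrite -addrA; congr (_ + (_ + _)).
  by apply: eq_bigr => y _; rewrite ffunE /= addr0.
rewrite -(aux (fun x y => f (x, y, Some a)) (fun x y => g (x, y, None))
              (fun x y => h (x, y, None))).
by apply: eq_bigr => y _; rewrite ffunE /= addr0.
Qed.

Lemma mcompDl T0 T1 T2 (f f' : mor A T0 T1) (g : mor A T1 T2) :
  (f + f') ** g = f ** g + f' ** g.
Proof.
apply/ffunP => -[[x z] o]; rewrite !ffunE /=.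
rewrite addrACA -big_split /=; congr (_ + _).
  by apply: eq_bigr => y _; rewrite !ffunE mulrDl.
case: o => [a|]; last by rewrite addr0.
by rewrite -big_split /=; apply: eq_bigr => y _; rewrite !ffunE mulrDl.
Qed.

Lemma mcompDr T0 T1 T2 (f : mor A T0 T1) (g g' : mor A T1 T2) :
  f ** (g + g') = f ** g + f ** g'.
Proof.
apply/ffunP => -[[x z] o]; rewrite !ffunE /=.
rewrite addrACA -big_split /=; congr (_ + _).
  by apply: eq_bigr => y _; rewrite !ffunE mulrDr.
case: o => [a|]; last by rewrite addr0.
by rewrite -big_split /=; apply: eq_bigr => y _; rewrite !ffunE mulrDr.
Qed.

Lemma mcomp0l T0 T1 T2 (g : mor A T1 T2) : (0 : mor A T0 T1) ** g = 0.
Proof. by apply: (addIr (0 ** g)); rewrite -mcompDl !add0r. Qed.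

Lemma mcomp0r T0 T1 T2 (f : mor A T0 T1) : f ** (0 : mor A T1 T2) = 0.
Proof. by apply: (addIr (f ** 0)); rewrite -mcompDr !add0r. Qed.

Lemma mcomp1l T0 T1 (f : mor A T0 T1) : idm T0 ** f = f.
Proof.
apply/ffunP => -[[x z] o]; rewrite !ffunE /=.
rewrite (bigD1 x) //= ffunE eqxx mul1r big1 ?addr0; last first.
  by move=> y ne; rewrite ffunE eq_sym (negPf ne) mul0r.
case: o => [a|]; last by rewrite addr0.
by rewrite big1 ?addr0 // => y _; rewrite ffunE mul0r.
Qed.

Lemma mcomp1r T0 T1 (f : mor A T0 T1) : f ** idm T1 = f.
Proof.
apply/ffunP => -[[x z] o]; rewrite !ffunE /=.
case: o => [a|].
  rewrite big1 ?add0r; last by move=> y _; rewrite ffunE mulr0.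
  rewrite (bigD1 z) //= ffunE eqxx mulr1 big1 ?addr0 // => y ne.
  by rewrite ffunE (negPf ne) mulr0.
rewrite addr0 (bigD1 z) //= ffunE eqxx mulr1 big1 ?addr0 // => y ne.
by rewrite ffunE (negPf ne) mulr0.
Qed.

Lemma mcomp_lift0 T0 T1 T2 (M : T0 -> T1 -> 'F_2) (N : T1 -> T2 -> 'F_2) :
  lift0 M ** lift0 N = lift0 (fun x z => \sum_y M x y * N y z).
Proof.
apply/ffunP => -[[x z] [a|]]; rewrite !ffunE /=.
  rewrite !big1 ?addr0 // => y _; rewrite !ffunE ?mulr0 ?mul0r //.
by rewrite addr0; apply: eq_bigr => y _; rewrite !ffunE.
Qed.

Lemma mcomp_scalel T0 T1 T2 c (f : mor A T0 T1) (g : mor A T1 T2) :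
  (c *: f) ** g = c *: (f ** g).
Proof.
apply/ffunP => -[[x z] o]; rewrite !ffunE /= scalerDr !scaler_sumr.
congr (_ + _).
  by apply: eq_bigr => y _; rewrite !ffunE /= -scalerAl.
case: o => [a|]; last by rewrite scaler0.
by rewrite scaler_sumr; apply: eq_bigr => y _; rewrite !ffunE /= -scalerAl.
Qed.

Lemma mcomp_scaler T0 T1 T2 c (f : mor A T0 T1) (g : mor A T1 T2) :
  f ** (c *: g) = c *: (f ** g).
Proof.
apply/ffunP => -[[x z] o]; rewrite !ffunE /= scalerDr !scaler_sumr.
congr (_ + _).
  by apply: eq_bigr => y _; rewrite !ffunE /= scalerAr.
case: o => [a|]; last by rewrite scaler0.
by rewrite scaler_sumr; apply: eq_bigr => y _; rewrite !ffunE /= scalerAr.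
Qed.

(** Over F_2 transposition reverses composition without signs; with the arrows reversed as well it
    becomes the duality with the opposite quiver. *)
Definition trh T T' (f : mor A T T') : mor A T' T :=
  [ffun t => f (t.1.2, t.1.1, t.2)].

Lemma trhK T T' (f : mor A T T') : trh (trh f) = f.
Proof. by apply/ffunP => -[[x y] o]; rewrite !ffunE. Qed.

Lemma trhD T T' (f g : mor A T T') : trh (f + g) = trh f + trh g.
Proof. by apply/ffunP => -[[x y] o]; rewrite !ffunE. Qed.

Lemma trh0 T T' : trh (0 : mor A T T') = 0.
Proof. by apply/ffunP => -[[x y] o]; rewrite !ffunE. Qed.

Lemma trh_id T : trh (idm T) = idm T.
Proof. by apply/ffunP => -[[x y] [a|]]; rewrite !ffunE //= eq_sym. Qed.

Lemma trh_mcomp T T' T'' (f : mor A T T') (g : mor A T' T'') :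
  trh (f ** g) = trh g ** trh f.
Proof.
apply/ffunP => -[[x y] [a|]]; rewrite !ffunE //=; last first.
  by rewrite !addr0; apply: eq_bigr => z _; rewrite !ffunE mulrC.
by rewrite addrC; congr (_ + _); apply: eq_bigr => z _; rewrite !ffunE mulrC.
Qed.

End Composition.

Notation "f ** g" := (mcomp f g) (at level 40, left associativity).

Record shape n := Shape { idx :> finType; vtx : idx -> 'I_n; deg : idx -> int }.

Definition arrow_deg (A : finType) (o : option A) : int := if o is Some _ then 1 else 0.

Section Degree.
Variables (n : nat) (Q : quiver n).
Local Notation A := (arrow Q).
Implicit Types X Y Z : shape n.

Definition compat (o : option A) (v w : 'I_n) :=
  if o is Some a then (src a == v) && (tgt a == w) else v == w.

Definition allowed X Y (m : int) (t : (X * Y * option A)%type) :=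
  compat t.2 (vtx t.1.1) (vtx t.1.2)
  && (deg t.1.2 + arrow_deg t.2 == deg t.1.1 + m).

Definition homog X Y (m : int) (f : mor A X Y) := forall t, f t != 0 -> allowed m t.

Lemma homog0 X Y m : @homog X Y m 0.
Proof. by move=> t; rewrite ffunE eqxx. Qed.

Lemma homogD X Y m (f g : mor A X Y) : homog m f -> homog m g -> homog m (f + g).
Proof.
move=> hf hg t; rewrite ffunE; have [->|nf _] := eqVneq (f t) 0; last exact: hf.
by rewrite add0r; apply: hg.
Qed.

Lemma sum_neq0 (T : finType) (F : T -> 'F_2) : \sum_y F y != 0 -> exists y, F y != 0.
Proof.
move=> n0; apply/existsP; apply: contraNT n0; rewrite negb_exists => /forallP h.
by apply/eqP/big1 => y _; apply/eqP/negPn/h.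
Qed.

Lemma homog_comp X Y Z m m' (f : mor A X Y) (g : mor A Y Z) :
  homog m f -> homog m' g -> homog (m + m') (f ** g).
Proof.
move=> hf hg [[x z] o]; rewrite ffunE /=.
have [e|/sum_neq0[y]] := eqVneq (\sum_y f (x, y, None) * g (y, z, o)) 0; last first.
  rewrite mulf_eq0 negb_or => /andP[/hf + /hg + _].
  rewrite /allowed /= => /andP[/eqP-> /eqP e1] /andP[-> /eqP e2] /=.
  by apply/eqP; lia.
rewrite e add0r; case: o {e} => [a|]; last by rewrite eqxx.
case/sum_neq0=> y.
rewrite mulf_eq0 negb_or => /andP[/hf + /hg +].
rewrite /allowed /= => /andP[+ /eqP e1] /andP[/eqP<- /eqP e2] /= => ->.
by apply/eqP; lia.
Qed.

Lemma homog_lift0 X Y m (M : X -> Y -> 'F_2) :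
  (forall x y, M x y != 0 -> vtx x = vtx y /\ deg y = deg x + m) ->
  homog m (lift0 A M).
Proof.
move=> h [[x y] o]; rewrite ffunE /allowed /=; case: o => [a|]; first by rewrite eqxx.
by case/h => e1 e2; rewrite /= e1 e2 addr0 !eqxx.
Qed.

Lemma homog_id X : homog 0 (idm A X : mor A X X).
Proof.
apply: homog_lift0 => x y; case: (eqVneq x y) => [->|_]; last by move/eqP.
by rewrite addr0.
Qed.

End Degree.

(* A bounded complex of representations with a homogeneous basis: the scalar part of
   [bd] is the differential and its coefficient at an arrow is the action of that
   arrow.  Arrows have degree 1, so that the degree m morphisms modulo homotopy
   compute Hom(X, Y[m]) in the derived category. *)
Record cplx n (Q : quiver n) := Cplx
  { shp :> shape n;
    bd : mor (arrow Q) shp shp;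
    bd_homog : homog 1 bd;
    bd_sq : bd ** bd = 0 }.

Fact dif_key : unit. Proof. by []. Qed.

Section Differential.
Variables (n : nat) (Q : quiver n).
Local Notation A := (arrow Q).
Implicit Types X Y Z W P : cplx Q.

(* Locked, as rewriting with bilinearity would otherwise unfold differentials. *)
Definition dif X Y (f : mor A X Y) : mor A X Y :=
  locked_with dif_key (bd X ** f + f ** bd Y).

Lemma difE X Y (f : mor A X Y) : dif f = bd X ** f + f ** bd Y.
Proof. by rewrite /dif unlock. Qed.

Lemma difD X Y (f g : mor A X Y) : dif (f + g) = dif f + dif g.
Proof. by rewrite !difE mcompDl mcompDr addrACA. Qed.

Lemma dif0 X Y : dif (0 : mor A X Y) = 0.
Proof. by rewrite !difE mcomp0l mcomp0r addr0. Qed.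

Lemma difZ X Y c (f : mor A X Y) : dif (c *: f) = c *: dif f.
Proof. by rewrite !difE mcomp_scalel mcomp_scaler scalerDr. Qed.

Lemma dif_comp X Y Z (f : mor A X Y) (g : mor A Y Z) :
  dif (f ** g) = dif f ** g + f ** dif g.
Proof. by rewrite !difE mcompDl mcompDr !mcompA addrA addfK. Qed.

Lemma dif_dif X Y (f : mor A X Y) : dif (dif f) = 0.
Proof.
rewrite !difE !mcompDl !mcompDr !mcompA bd_sq mcomp0l add0r.
by rewrite -[f ** bd Y ** bd Y]mcompA bd_sq mcomp0r addr0 addff.
Qed.

Lemma dif_id X : dif (idm A X : mor A X X) = 0.
Proof. by rewrite !difE mcomp1l mcomp1r addff. Qed.

Lemma homog_dif X Y m (f : mor A X Y) : homog m f -> homog (m + 1) (dif f).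
Proof.
move=> h; rewrite difE; apply: homogD; last exact: homog_comp (@bd_homog _ _ Y).
by rewrite addrC; apply: homog_comp => //; apply: bd_homog.
Qed.

Definition cocycle X Y m (f : mor A X Y) := homog m f /\ dif f = 0.
Definition bounds X Y m (f : mor A X Y) := exists2 h, homog (m - 1) h & f = dif h.

(* The cohomology H^m(X, Y) is zero. *)
Definition acyclic_at m X Y := forall f : mor A X Y, cocycle m f -> bounds m f.

(* H^0(X, X) = F_2. *)
Definition brick X :=
  ~ bounds 0 (idm A X : mor A X X) /\
  forall f : mor A X X, cocycle 0 f -> bounds 0 f \/ bounds 0 (f + idm A X).

Lemma boundsD X Y m (f g : mor A X Y) : bounds m f -> bounds m g -> bounds m (f + g).
Proof.
by case=> h hh -> [k hk ->]; exists (h + k); rewrite ?difD //; apply: homogD.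
Qed.

Lemma bounds0 X Y m : bounds m (0 : mor A X Y).
Proof. by exists 0; rewrite ?dif0 //; apply: homog0. Qed.

Lemma bounds_cocycle X Y m (f : mor A X Y) : bounds m f -> cocycle m f.
Proof.
case=> h hh ->; split; last exact: dif_dif.
by rewrite -[m](subrK 1); apply: homog_dif.
Qed.

Lemma cocycleD X Y m (f g : mor A X Y) :
  cocycle m f -> cocycle m g -> cocycle m (f + g).
Proof.
by case=> hf df [hg dg]; split; [apply: homogD | rewrite difD df dg addr0].
Qed.

Lemma cocycle_id X : cocycle 0 (idm A X : mor A X X).
Proof. by split; [apply: homog_id | apply: dif_id]. Qed.

Lemma cocycle_comp X Y Z m m' (f : mor A X Y) (g : mor A Y Z) :
  cocycle m f -> cocycle m' g -> cocycle (m + m') (f ** g).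
Proof.
case=> hf df [hg dg]; split; first exact: homog_comp.
by rewrite dif_comp df dg mcomp0l mcomp0r addr0.
Qed.

Lemma bounds_compl X Y Z m m' (f : mor A X Y) (g : mor A Y Z) :
  bounds m f -> cocycle m' g -> bounds (m + m') (f ** g).
Proof.
case=> h hh -> [hg dg]; exists (h ** g); last by rewrite dif_comp dg mcomp0r addr0.
by rewrite addrAC; apply: homog_comp.
Qed.

Lemma bounds_compr X Y Z m m' (f : mor A X Y) (g : mor A Y Z) :
  cocycle m f -> bounds m' g -> bounds (m + m') (f ** g).
Proof.
case=> hf df [h hh ->]; exists (f ** h); last by rewrite dif_comp df mcomp0l add0r.
by rewrite -addrA; apply: homog_comp.
Qed.

End Differential.

(** * Duality with the opposite quiver *)

Section Opposite.
Variables (n : nat) (Q : quiver n).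
Local Notation A := (arrow Q).
Implicit Types X Y Z W P : cplx Q.

(* The regrading exchanges the degrees 0 and -1, that is, positive and negative
   c-vectors. *)
Definition ops (X : shape n) : shape n := @Shape n X (@vtx n X) (fun x => -1 - deg x).

Lemma homog_trh (X Y : shape n) m (f : mor A X Y) :
  homog m f -> @homog n (opq Q) (ops Y) (ops X) m (trh f).
Proof.
move=> h [[y x] o]; rewrite ffunE => /h; rewrite /allowed /=.
move=> /andP[c /eqP e]; apply/andP; split; last by apply/eqP; lia.
by case: o c {e} => [a|] /=; [rewrite andbC | rewrite eq_sym].
Qed.

Lemma homog_trh' (X Y : shape n) m (f : mor A X Y) :
  @homog n (opq Q) (ops X) (ops Y) m f -> @homog n Q Y X m (trh f).
Proof.
move=> h [[y x] o]; rewrite ffunE => /h; rewrite /allowed /=.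
move=> /andP[c /eqP e]; apply/andP; split; last by apply/eqP; lia.
by case: o c {e} => [a|] /=; [rewrite andbC | rewrite eq_sym].
Qed.

End Opposite.

Section OppositeComplex.
Variables (n : nat) (Q : quiver n).
Local Notation A := (arrow Q).
Implicit Types X Y Z W P : cplx Q.

Lemma opc_sq X : trh (bd X) ** trh (bd X) = 0.
Proof. by rewrite -trh_mcomp bd_sq trh0. Qed.

Definition opc X : cplx (opq Q) :=
  @Cplx n (opq Q) (ops X) (trh (bd X)) (homog_trh (@bd_homog n Q X)) (opc_sq X).

Lemma dif_trh X Y (f : mor A X Y) :
  @dif n (opq Q) (opc Y) (opc X) (trh f) = trh (dif f).
Proof. by rewrite !difE /= trhD !trh_mcomp addrC. Qed.

Lemma bounds_trh X Y m (f : mor A X Y) :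
  bounds m f -> @bounds n (opq Q) (opc Y) (opc X) m (trh f).
Proof. by case=> h hh ->; exists (trh h); [apply: homog_trh | rewrite dif_trh]. Qed.

Lemma bounds_trh' X Y m (f : mor A X Y) :
  @bounds n (opq Q) (opc Y) (opc X) m (trh f) -> bounds m f.
Proof.
case=> h hh e; exists (trh h : mor A X Y); first exact: homog_trh'.
by rewrite -[f]trhK e -[h in LHS](trhK h) dif_trh trhK.
Qed.

Lemma cocycle_trh X Y m (f : mor A X Y) :
  cocycle m f -> @cocycle n (opq Q) (opc Y) (opc X) m (trh f).
Proof. by case=> h d; split; [apply: homog_trh | rewrite dif_trh d trh0]. Qed.

Lemma cocycle_trh' X Y m (f : mor A X Y) :
  @cocycle n (opq Q) (opc X) (opc Y) m f -> @cocycle n Q Y X m (trh f).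
Proof.
case=> h d; split; first exact: homog_trh'.
by apply: (can_inj (@trhK _ _ _)); rewrite -dif_trh trhK trh0.
Qed.

Lemma acyclic_op X Y m : acyclic_at m X Y -> acyclic_at m (opc Y) (opc X).
Proof. by move=> a f /cocycle_trh'/a/bounds_trh; rewrite trhK. Qed.

Lemma brick_op X : brick X -> brick (opc X).
Proof.
case=> h1 h2; split.
  by move=> b; apply: h1; apply: bounds_trh'; rewrite trh_id.
move=> f /cocycle_trh'/h2[/bounds_trh|/bounds_trh]; rewrite ?trhD trhK ?trh_id.
  by left.
by right.
Qed.

End OppositeComplex.

(** * Cones and extensions *)

(** As a graded space Z is the direct sum of P and X, and [xi] is added to its differential: P is a
    subcomplex with quotient X. Axioms on the four structure maps are used instead of a fixed direct
    sum because they are self-dual. *)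
Record cone_of n (Q : quiver n) (P X Z : cplx Q) (xi : mor (arrow Q) X P) := ConeOf {
  cxi : cocycle 1 xi;
  iP : mor (arrow Q) P Z;
  pP : mor (arrow Q) Z P;
  iX : mor (arrow Q) X Z;
  pX : mor (arrow Q) Z X;
  hiP : homog 0 iP; hpP : homog 0 pP; hiX : homog 0 iX; hpX : homog 0 pX;
  ipP : iP ** pP = idm _ P;
  ipX : iX ** pX = idm _ X;
  iPpX : iP ** pX = 0;
  iXpP : iX ** pP = 0;
  cone_split : pP ** iP + pX ** iX = idm _ Z;
  dif_iP : dif iP = 0;
  dif_pX : dif pX = 0;
  dif_pP : dif pP = pX ** xi;
  dif_iX : dif iX = xi ** iP }.

Arguments hiP {n Q P X Z xi} c t _.
Arguments hpP {n Q P X Z xi} c t _.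
Arguments hiX {n Q P X Z xi} c t _.
Arguments hpX {n Q P X Z xi} c t _.

Section Cone.
Variables (n : nat) (Q : quiver n).
Local Notation A := (arrow Q).
Implicit Types X Y Z W P : cplx Q.

(** Duality exchanges subobject and quotient. The definition is transparent because [cone_ext] needs
    [iP (cone_op c)] to compute to [trh (pX c)]. *)
Definition cone_op P X Z (xi : mor A X P) (c : cone_of Z xi) :
  @cone_of n (opq Q) (opc X) (opc P) (opc Z) (trh xi).
Proof.
apply: (@ConeOf n (opq Q) (opc X) (opc P) (opc Z) (trh xi) _
  (trh (pX c)) (trh (iX c)) (trh (pP c)) (trh (iP c))).
- exact: cocycle_trh (cxi c).
- exact: homog_trh (hpX c).
- exact: homog_trh (hiX c).
- exact: homog_trh (hpP c).
- exact: homog_trh (hiP c).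
- by move: (congr1 (@trh _ _ _) (ipX c)); rewrite trh_mcomp trh_id.
- by move: (congr1 (@trh _ _ _) (ipP c)); rewrite trh_mcomp trh_id.
- by move: (congr1 (@trh _ _ _) (iPpX c)); rewrite trh_mcomp trh0.
- by move: (congr1 (@trh _ _ _) (iXpP c)); rewrite trh_mcomp trh0.
- by move: (congr1 (@trh _ _ _) (cone_split c)); rewrite trhD !trh_mcomp trh_id addrC.
- by rewrite dif_trh dif_pX trh0.
- by rewrite dif_trh dif_iP trh0.
- by rewrite dif_trh dif_iX trh_mcomp.
- by rewrite dif_trh dif_pP trh_mcomp.
Defined.

Variables (P X Z : cplx Q) (xi : mor A X P) (c : cone_of Z xi).
Local Notation iP := (iP c).
Local Notation pP := (pP c).
Local Notation iX := (iX c).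
Local Notation pX := (pX c).

Lemma cocycle_pX : cocycle 0 pX.
Proof. by split; [apply: hpX | apply: dif_pX]. Qed.

Lemma cocycle_iP : cocycle 0 iP.
Proof. by split; [apply: hiP | apply: dif_iP]. Qed.

Lemma homog0r (S S' S'' : shape n) m (f : mor A S S') (g : mor A S' S'') :
  homog m f -> homog 0 g -> homog m (f ** g).
Proof. by move=> hf hg; rewrite -[m]addr0; apply: homog_comp. Qed.

Lemma homog0l (S S' S'' : shape n) m (f : mor A S S') (g : mor A S' S'') :
  homog 0 f -> homog m g -> homog m (f ** g).
Proof. by move=> hf hg; rewrite -[m]add0r; apply: homog_comp. Qed.

(* Exactness of H^m(W, P) -> H^m(W, Z) -> H^m(W, X) -> H^{m+1}(W, P). *)

Lemma cone_post_inj W m (f : mor A W Z) :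
  acyclic_at m W P -> cocycle m f -> bounds m (f ** pX) -> bounds m f.
Proof.
move=> aP cf [a ha ea].
(* Adding a boundary makes the component in X vanish strictly and not only up to homotopy; what
   remains is a cocycle into P. *)
pose f' := f + dif (a ** iX).
have cf' : cocycle m f'.
  apply: cocycleD => //; apply: bounds_cocycle; exists (a ** iX) => //.
  exact: homog0r _ (hiX c).
have f'X : f' ** pX = 0.
  rewrite /f' dif_comp dif_iX !mcompDl ea -!mcompA ipX iPpX !mcomp0r mcomp1r.
  by rewrite addr0 addff.
have f'P : f' = f' ** pP ** iP.
  rewrite -[LHS]mcomp1r -(cone_split c) mcompDr !mcompA f'X mcomp0l addr0 //.
have [b hb eb] : bounds m (f' ** pP).
  apply: aP; split; first exact: homog0r cf'.1 (hpP c).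
  by rewrite dif_comp cf'.2 dif_pP mcompA f'X !mcomp0l addr0.
have -> : f = f' + dif (a ** iX) by rewrite /f' addfK.
apply: boundsD; last by exists (a ** iX) => //; exact: homog0r _ (hiX c).
rewrite f'P eb; exists (b ** iP); first exact: homog0r _ (hiP c).
by rewrite dif_comp dif_iP mcomp0r addr0.
Qed.

Lemma cone_post_surj W m (f : mor A W X) :
  acyclic_at (m + 1) W P -> cocycle m f -> exists2 f' : mor A W Z, cocycle m f' & f' ** pX = f.
Proof.
move=> aP cf.
have [b hb eb] : bounds (m + 1) (f ** xi).
  by apply: aP; apply: cocycle_comp => //; apply: cxi c.
rewrite addrK in hb.
exists (f ** iX + b ** iP); last first.
  by rewrite mcompDl -!mcompA ipX iPpX mcomp0r addr0 mcomp1r.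
split; first by apply: homogD; [apply: homog0r cf.1 (hiX c) | exact: homog0r _ (hiP c)].
rewrite difD !dif_comp cf.2 dif_iX dif_iP mcomp0l add0r mcomp0r addr0 -eb.
by rewrite mcompA addff.
Qed.

Lemma cone_iP_inj W m (f : mor A W P) :
  acyclic_at (m - 1) W X -> cocycle m f -> bounds m (f ** iP) -> bounds m f.
Proof.
move=> aX cf [a ha ea].
have [b hb eb] : bounds (m - 1) (a ** pX).
  apply: aX; split; first exact: homog0r _ (hpX c).
  by rewrite dif_comp -ea dif_pX mcomp0r addr0 -mcompA iPpX mcomp0r.
(* The same correction, applied to the homotopy [a] instead of the cocycle: its differential does
   not change and its component in X becomes zero. *)
pose a' := a + dif (b ** iX).
have ha' : homog (m - 1) a'.
  apply: homogD => //; rewrite -[m - 1](subrK 1); apply: homog_dif.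
  exact: homog0r _ (hiX c).
have a'X : a' ** pX = 0.
  rewrite /a' mcompDl eb dif_comp dif_iX mcompDl -!mcompA ipX iPpX !mcomp0r mcomp1r.
  by rewrite addr0 addff.
exists (a' ** pP); first exact: homog0r _ (hpP c).
rewrite dif_comp dif_pP mcompA a'X mcomp0l addr0 /a' difD dif_dif addr0 -ea.
by rewrite -mcompA ipP mcomp1r.
Qed.

Lemma cone_iP_surj W m (f : mor A W Z) :
  acyclic_at m W X -> cocycle m f ->
  exists2 f' : mor A W P, cocycle m f' & bounds m (f + f' ** iP).
Proof.
move=> aX cf.
have [b hb eb] : bounds m (f ** pX).
  by apply: aX; rewrite -[m]addr0; apply: cocycle_comp cocycle_pX.
have bb : bounds m (dif (b ** iX)).
  by exists (b ** iX) => //; exact: homog0r _ (hiX c).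
pose f0 := f + dif (b ** iX).
have cf0 : cocycle m f0 by apply: cocycleD (bounds_cocycle bb).
have f0X : f0 ** pX = 0.
  rewrite /f0 mcompDl eb dif_comp dif_iX mcompDl -!mcompA ipX iPpX !mcomp0r mcomp1r.
  by rewrite addr0 addff.
exists (f0 ** pP).
  split; first exact: homog0r cf0.1 (hpP c).
  by rewrite dif_comp cf0.2 dif_pP mcompA f0X !mcomp0l addr0.
suff -> : f0 ** pP ** iP = f0 by rewrite /f0 addKf.
by rewrite -[RHS]mcomp1r -(cone_split c) mcompDr !mcompA f0X mcomp0l addr0.
Qed.

End Cone.

(* What remains of the long exact sequences when Z has a filtration with quotient X
   all of whose other layers are copies of P; unlike being a cone, this is closed
   under composition and homotopy equivalence. *)
Record ext_by n (Q : quiver n) (P X Z : cplx Q) (phi : mor (arrow Q) Z X) : Prop := ExtBy {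
  ext_cocycle : cocycle 0 phi;
  ext_post_inj : forall (W : cplx Q) m (f : mor (arrow Q) W Z), acyclic_at m W P ->
    cocycle m f -> bounds m (f ** phi) -> bounds m f;
  ext_post_surj : forall (W : cplx Q) m (f : mor (arrow Q) W X), acyclic_at (m + 1) W P ->
    cocycle m f ->
    exists2 f' : mor (arrow Q) W Z, cocycle m f' & bounds m (f + f' ** phi);
  ext_pre_inj : forall (W : cplx Q) m (f : mor (arrow Q) X W), acyclic_at (m - 1) P W ->
    cocycle m f -> bounds m (phi ** f) -> bounds m f;
  ext_pre_surj : forall (W : cplx Q) m (f : mor (arrow Q) Z W), acyclic_at m P W ->
    cocycle m f ->
    exists2 f' : mor (arrow Q) X W, cocycle m f' & bounds m (f + phi ** f') }.

Section Extension.
Variables (n : nat) (Q : quiver n).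
Local Notation A := (arrow Q).
Implicit Types X Y Z W P : cplx Q.

(** The two clauses on precomposition are the exactness statements for [iP] in the opposite cone,
    whose [iP] is the transpose of [pX]. *)
Lemma cone_ext P X Z (xi : mor A X P) (c : cone_of Z xi) : ext_by P (pX c).
Proof.
split.
- exact: cocycle_pX.
- by move=> W m f; apply: cone_post_inj.
- move=> W m f a /(cone_post_surj c a)[f' cf' <-]; exists f' => //.
  by rewrite addff; apply: bounds0.
- move=> W m f /acyclic_op a /cocycle_trh cf /bounds_trh b; apply: bounds_trh'.
  refine (@cone_iP_inj _ _ _ _ _ _ (cone_op c) (opc W) m (trh f) a cf _).
  by rewrite /= -trh_mcomp.
- move=> W m f /acyclic_op a /cocycle_trh cf.
  have [f' cf' b] := cone_iP_surj (cone_op c) a cf.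
  exists (trh f'); first exact: cocycle_trh'.
  by apply: bounds_trh'; rewrite trhD trh_mcomp trhK.
Qed.

Lemma ext_comp P X Y Z (phi : mor A Y X) (psi : mor A Z Y) :
  ext_by P phi -> ext_by P psi -> ext_by P (psi ** phi).
Proof.
case=> c1 pi1 ps1 ri1 rs1 [c2 pi2 ps2 ri2 rs2].
have cf m W (f : mor A W Y) : cocycle m f -> cocycle m (f ** phi).
  by move=> h; rewrite -[m]addr0; apply: cocycle_comp.
have cf2 m W (f : mor A W Z) : cocycle m f -> cocycle m (f ** psi).
  by move=> h; rewrite -[m]addr0; apply: cocycle_comp.
have cg m W (f : mor A Y W) : cocycle m f -> cocycle m (psi ** f).
  by move=> h; rewrite -[m]add0r; apply: cocycle_comp.
have cg1 m W (f : mor A X W) : cocycle m f -> cocycle m (phi ** f).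
  by move=> h; rewrite -[m]add0r; apply: cocycle_comp.
split.
- by rewrite -[0]addr0; apply: cocycle_comp.
- by move=> W m f a h b; apply: pi2 => //; apply: pi1 => //; [apply: cf2 | rewrite -mcompA].
- move=> W m f a h; have [f1 h1 b1] := ps1 _ _ _ a h; have [f2 h2 b2] := ps2 _ _ _ a h1.
  exists f2 => //; rewrite mcompA -[f](addfK _ (f1 ** phi)) -addrA -mcompDl.
  by apply: boundsD => //; rewrite -[m]addr0; apply: bounds_compl c1.
- by move=> W m f a h b; apply: ri1 => //; apply: ri2 => //; [apply: cg1 | rewrite mcompA].
- move=> W m f a h; have [f1 h1 b1] := rs2 _ _ _ a h; have [f2 h2 b2] := rs1 _ _ _ a h1.
  exists f2 => //; rewrite -mcompA -[f](addfK _ (psi ** f1)) -addrA -mcompDr.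
  by apply: boundsD => //; rewrite -[m]add0r; apply: bounds_compr.
Qed.

Lemma heq_ext P X Z (phi : mor A Z X) (psi : mor A X Z) :
  cocycle 0 phi -> cocycle 0 psi ->
  bounds 0 (phi ** psi + idm A Z) -> bounds 0 (psi ** phi + idm A X) -> ext_by P phi.
Proof.
move=> c1 c2 b1 b2; split=> //.
- move=> W m f _ cf b.
  rewrite -[f](addKf _ (f ** (phi ** psi))); apply: boundsD.
    by rewrite mcompA -[m]addr0; apply: bounds_compl c2.
  by rewrite -[f in X in _ + X]mcomp1r -mcompDr -[m]addr0; apply: bounds_compr.
- move=> W m f _ cf; exists (f ** psi); first by rewrite -[m]addr0; apply: cocycle_comp.
  rewrite -mcompA -[f in X in X + _]mcomp1r -mcompDr addrC -[m]addr0.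
  by apply: bounds_compr => //; rewrite addrC.
- move=> W m f _ cf b.
  rewrite -[f](addKf _ (psi ** phi ** f)); apply: boundsD.
    by rewrite -mcompA -[m]add0r; apply: bounds_compr.
  by rewrite -[f in X in _ + X]mcomp1l -mcompDl -[m]add0r; apply: bounds_compl cf.
- move=> W m f _ cf; exists (psi ** f); first by rewrite -[m]add0r; apply: cocycle_comp.
  rewrite mcompA -[f in X in X + _]mcomp1l -mcompDl -[m]add0r.
  by apply: bounds_compl cf; rewrite addrC.
Qed.

Lemma ext_id P X : ext_by P (idm A X : mor A X X).
Proof.
apply: (@heq_ext _ _ _ _ (idm A X)); try exact: cocycle_id;
  by rewrite mcomp1l addff; apply: bounds0.
Qed.

Section Consequences.
Variables (P X Z : cplx Q) (phi : mor A Z X) (e : ext_by P phi).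

Lemma ext_acyclic_post W m :
  acyclic_at m W P -> acyclic_at m W X -> acyclic_at m W Z.
Proof.
move=> aP aX f cf; apply: (ext_post_inj e) => //; apply: aX.
by rewrite -[m]addr0; apply: cocycle_comp (ext_cocycle e).
Qed.

Lemma ext_acyclic_post' W m :
  acyclic_at (m + 1) W P -> acyclic_at m W Z -> acyclic_at m W X.
Proof.
move=> aP aZ f cf; have [f' cf' b] := ext_post_surj e aP cf.
rewrite -[f](addfK _ (f' ** phi)); apply: boundsD => //.
by rewrite -[m]addr0; apply: bounds_compl (ext_cocycle e); apply: aZ.
Qed.

Lemma ext_acyclic_pre W m :
  acyclic_at m P W -> acyclic_at m X W -> acyclic_at m Z W.
Proof.
move=> aP aX f cf; have [f' cf' b] := ext_pre_surj e aP cf.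
rewrite -[f](addfK _ (phi ** f')); apply: boundsD => //.
by rewrite -[m]add0r; apply: bounds_compr (ext_cocycle e) _; apply: aX.
Qed.

Lemma ext_acyclic_pre' W m :
  acyclic_at (m - 1) P W -> acyclic_at m Z W -> acyclic_at m X W.
Proof.
move=> aP aZ f cf; apply: (ext_pre_inj e) => //; apply: aZ.
by rewrite -[m]add0r; apply: cocycle_comp (ext_cocycle e) _.
Qed.

(** Composition with [phi] embeds H^0(Z, Z) into H^0(Z, X), because H^0(Z, P) = 0, and identifies
    H^0(X, X) with H^0(Z, X), because H^0(P, X) and H^{-1}(P, X) vanish. Both identities go to
    [phi]. *)
Lemma ext_brick :
  acyclic_at 0 Z P -> acyclic_at 1 Z P -> acyclic_at 0 P X -> acyclic_at (- 1) P X ->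
  brick X -> brick Z.
Proof.
move=> a0 a1 b0 b1 [nid bX].
have cphi := ext_cocycle e.
split=> [b|f cf].
  apply: nid; apply: (ext_pre_inj e); first by rewrite sub0r.
    exact: cocycle_id.
  by rewrite mcomp1r -[phi]mcomp1l -[0]addr0; apply: bounds_compl cphi.
have [|g cg bg] := @ext_pre_surj _ _ _ _ _ _ e X 0 (f ** phi) b0.
  by rewrite -[0]addr0; apply: cocycle_comp.
have [bb|bb] := bX g cg; [left | right]; apply: (ext_post_inj e) => //.
- rewrite -[f ** phi](addfK _ (phi ** g)); apply: boundsD => //.
  by rewrite -[0]add0r; apply: bounds_compr.
- by apply: cocycleD => //; apply: cocycle_id.
- rewrite mcompDl mcomp1l -[f ** phi](addfK _ (phi ** g)) -addrA; apply: boundsD => //.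
  rewrite -[phi in X in _ + X]mcomp1r -mcompDr -[0]add0r; exact: bounds_compr.
Qed.

End Consequences.
End Extension.

(** * Dimensions of cohomology groups *)

(** The map Z1/B1 -> Z2/B2 induced by [phi] is onto and kills the nonzero class of [u]. *)
Lemma ltn_dim_quotient (K : fieldType) (U V : vectType K) (phi : 'Hom(U, V))
    (Z1 B1 : {vspace U}) (Z2 B2 : {vspace V}) (u : U) :
  (B1 <= Z1)%VS -> (Z2 <= phi @: Z1 + B2)%VS -> (phi @: B1 <= B2)%VS ->
  u \in Z1 -> u \notin B1 -> phi u \in B2 ->
  (\dim Z2 - \dim B2 < \dim Z1 - \dim B1)%N.
Proof.
move=> sB sZ sphi uZ uB phiu.
(* Y/B1 is the kernel of the induced map; it is nonzero because of [u]. *)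
pose Y := (Z1 :&: phi @^-1: B2)%VS.
have ltBY : (\dim B1 < \dim Y)%N.
  have sBY : (B1 <= Y)%VS.
    rewrite subv_cap sB; apply/subvP => v vB; rewrite -memv_preim.
    by apply: (subvP sphi); apply: memv_img.
  rewrite ltnNge; apply/negP => le.
  have /eqP eBY : B1 == Y by rewrite eqEdim sBY.
  by move: uB; rewrite eBY memv_cap uZ -memv_preim phiu.
have leYZ : (\dim Y <= \dim Z1)%N by rewrite dimvS // capvSl.
have eZ := limg_ker_dim phi Z1.
have eY := limg_ker_dim phi Y.
have eK : (Y :&: lker phi)%VS = (Z1 :&: lker phi)%VS.
  apply/vspaceP => v; rewrite !memv_cap -memv_preim memv_ker.
  case: (v \in Z1) => //=; case: eqP => [->|_]; rewrite ?mem0v ?andbF //.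
have leS : (\dim (phi @: Y) <= \dim (phi @: Z1 :&: B2))%N.
  apply: dimvS; rewrite subv_cap limgS ?capvSl //=.
  by apply/subvP => _ /memv_imgP[v + ->]; rewrite memv_cap -memv_preim => /andP[].
have eD := dimv_sum_cap (phi @: Z1) B2.
have leZ := dimvS sZ.
rewrite eK in eY.
lia.
Qed.

Section GradedSpaces.
Variables (n : nat) (Q : quiver n).
Local Notation A := (arrow Q).

Definition elementary (X Y : shape n) (t : (X * Y * option A)%type) : mor A X Y :=
  [ffun t' => (t' == t)%:R].

Definition homog_space (X Y : shape n) (m : int) : {vspace mor A X Y} :=
  <<[seq elementary t | t <- enum (fun t : (X * Y * option A)%type => allowed m t)]>>%VS.

Lemma elementary_sum (X Y : shape n) (f : mor A X Y) :
  f = \sum_t f t *: elementary t.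
Proof.
apply/ffunP => t; rewrite sum_ffunE (bigD1 t) //= !ffunE eqxx big1 ?addr0.
  by rewrite /GRing.scale /= mulr1.
by move=> s ne; rewrite !ffunE eq_sym (negPf ne) scaler0.
Qed.

Lemma span_elementary (X Y : shape n) s (f : mor A X Y) t :
  f \in <<[seq elementary t | t <- s]>>%VS -> f t != 0 -> t \in s.
Proof.
elim: s f => [|u s IH] f /=.
  by rewrite span_nil memv0 => /eqP->; rewrite ffunE eqxx.
rewrite span_cons => /memv_addP[_ /vlineP[c ->] [g gs ->]].
rewrite !ffunE in_cons; case: (eqVneq t u) => //= _; rewrite [_ *: _]scaler0 add0r; exact: IH.
Qed.

Lemma homog_spaceP (X Y : shape n) m (f : mor A X Y) :
  reflect (homog m f) (f \in homog_space X Y m).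
Proof.
apply: (iffP idP) => [/span_elementary h t /h|h]; first by rewrite mem_enum.
rewrite [f]elementary_sum; apply: memv_suml => t _.
have [->|n0] := eqVneq (f t) 0; first by rewrite scale0r mem0v.
by apply: memvZ; apply: memv_span; apply: map_f; rewrite mem_enum; apply: h.
Qed.

Lemma dim_homog_space (X Y : shape n) m :
  \dim (homog_space X Y m) = #|[pred t : (X * Y * option A)%type | allowed m t]|.
Proof.
rewrite /homog_space cardE; set s := enum _; have : uniq s by apply: enum_uniq.
rewrite -(size_map (@elementary X Y)) => us; apply/eqP; change (free (map (@elementary X Y) s)).
elim: s us => [|t s IH] /=; first by rewrite nil_free.
case/andP=> ts us; rewrite free_cons IH // andbT.
by apply: contra ts => /span_elementary; apply; rewrite ffunE eqxx.
Qed.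

End GradedSpaces.

Section Cohomology.
Variables (n : nat) (Q : quiver n).
Local Notation A := (arrow Q).
Implicit Types X Y Z W P : cplx Q.

Lemma dif_linear X Y : linear (@dif n Q X Y).
Proof. by move=> c f g; rewrite difD difZ. Qed.

HB.instance Definition _ X Y :=
  GRing.isLinear.Build _ _ _ _ (@dif n Q X Y) (@dif_linear X Y).

Definition cocycles X Y m := (homog_space Q X Y m :&: lker (linfun (@dif n Q X Y)))%VS.
Definition boundaries X Y m := (linfun (@dif n Q X Y) @: homog_space Q X Y (m - 1))%VS.

Lemma cocyclesP X Y m (f : mor A X Y) : reflect (cocycle m f) (f \in cocycles X Y m).
Proof.
rewrite memv_cap memv_ker lfunE /=.
apply: (iffP andP) => -[h e].
  by split; [apply/homog_spaceP | apply/eqP].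
by split; [apply/homog_spaceP | apply/eqP].
Qed.

Lemma boundariesP X Y m (f : mor A X Y) : reflect (bounds m f) (f \in boundaries X Y m).
Proof.
apply: (iffP memv_imgP) => [[h /homog_spaceP hh ->]|[h /homog_spaceP hh ->]].
  by exists h; rewrite ?lfunE.
by exists h; rewrite ?lfunE.
Qed.

Lemma boundaries_sub X Y m : (boundaries X Y m <= cocycles X Y m)%VS.
Proof. by apply/subvP => f /boundariesP/bounds_cocycle/cocyclesP. Qed.

Lemma acyclicP X Y m : reflect (acyclic_at m X Y) (cocycles X Y m <= boundaries X Y m)%VS.
Proof.
apply: (iffP subvP) => h f; first by move=> /cocyclesP/h/boundariesP.
by move/cocyclesP/h/boundariesP.
Qed.

(** The truncated subtraction is exact by [boundaries_sub]. *)
Definition hdim X Y m := (\dim (cocycles X Y m) - \dim (boundaries X Y m))%N.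

Section Precomposition.
Variables (X Y W : cplx Q) (phi : mor A X Y).

Definition precomp (f : mor A Y W) : mor A X W := phi ** f.

Lemma precomp_linear : linear precomp.
Proof. by move=> c f g; rewrite /precomp mcompDr mcomp_scaler. Qed.

HB.instance Definition _ := GRing.isLinear.Build _ _ _ _ precomp precomp_linear.

End Precomposition.

(** Precomposition with [pX] maps H^1(X, P) onto H^1(Z, P), because H^1(P, P) = 0, and kills the
    class of [xi], because [pX ** xi] is the differential of [pP]. *)
Lemma cone_hdim P X Z (xi : mor A X P) (c : cone_of Z xi) :
  acyclic_at 1 P P -> ~ bounds 1 xi -> (hdim Z P 1 < hdim X P 1)%N.
Proof.
move=> aP nb; have e := cone_ext c.
apply: (@ltn_dim_quotient _ _ _ (linfun (@precomp Z X P (pX c))) _ _ _ _ xi).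
- exact: boundaries_sub.
- apply/subvP => f /cocyclesP cf; have [g cg b] := ext_pre_surj e aP cf.
  rewrite -[f](addKf _ (pX c ** g)); apply: memv_add.
    have -> : pX c ** g = linfun (@precomp Z X P (pX c)) g by rewrite lfunE.
    exact/memv_img/cocyclesP.
  by rewrite addrC; apply/boundariesP.
- apply/subvP => _ /memv_imgP[g /boundariesP b ->]; rewrite lfunE /=.
  by apply/boundariesP; rewrite -[1]add0r; apply: bounds_compr (cocycle_pX c) b.
- exact/cocyclesP/(cxi c).
- exact/boundariesP.
- rewrite lfunE /= /precomp -dif_pP; apply/boundariesP.
  by exists (pP c) => //; rewrite subrr; apply: hpP.
Qed.

(** The restriction [iP ** f] to the brick P is homotopic to 0 or to the identity. The identity is
    excluded: [xi ** iP] bounds, so [xi] would bound. In the remaining case [f] comes from X up to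
    homotopy, and H^0(X, P) = 0. *)
Lemma cone_acyclic0 P X Z (xi : mor A X P) (c : cone_of Z xi) :
  brick P -> acyclic_at 0 X P -> ~ bounds 1 xi -> acyclic_at 0 Z P.
Proof.
move=> [_ bP] aX nb f cf.
have cg : cocycle 0 (iP c ** f).
  by rewrite -[0]addr0; apply: cocycle_comp => //; apply: cocycle_iP.
have bxg : bounds 1 (xi ** (iP c ** f)).
  exists (iX c ** f); first by rewrite subrr -[0]addr0; apply: homog_comp cf.1; apply: hiX.
  by rewrite dif_comp cf.2 dif_iX mcomp0r addr0 mcompA.
case: (bP _ cg) => [[a ha ea]|b]; last first.
  case: nb; rewrite -[xi](addKf _ (xi ** (iP c ** f))); apply: boundsD => //.
  rewrite -[xi in X in _ + X]mcomp1r -mcompDr -[1]addr0.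
  by apply: bounds_compr (cxi c) b.
pose f' := f + dif (pP c ** a).
have bb : bounds 0 (dif (pP c ** a)).
  exists (pP c ** a) => //; rewrite sub0r in ha *; rewrite -[- 1]add0r.
  by apply: homog_comp => //; apply: hpP.
have cf' : cocycle 0 f' by apply: cocycleD => //; apply: bounds_cocycle.
have f'P : iP c ** f' = 0.
  rewrite /f' mcompDr ea dif_comp dif_pP mcompDr !mcompA iPpX !mcomp0l add0r.
  by rewrite ipP mcomp1l addff.
have [b hb eb] : bounds 0 (iX c ** f').
  apply: aX; split; first by rewrite -[0]addr0; apply: homog_comp cf'.1; apply: hiX.
  by rewrite dif_comp cf'.2 mcomp0r addr0 dif_iX -mcompA f'P mcomp0r.
rewrite -[f](addfK _ (dif (pP c ** a))); apply: boundsD => //; rewrite -/f'.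
rewrite -[f']mcomp1l -(cone_split c) mcompDl -!mcompA f'P mcomp0r add0r eb.
exists (pX c ** b); last by rewrite dif_comp dif_pX mcomp0l add0r.
by rewrite -[0 - 1]add0r; apply: homog_comp => //; apply: hpX.
Qed.

End Cohomology.

(** The class in the Grothendieck group, written in the basis of the simple representations. *)
Definition cls n (X : shape n) : 'cV[int]_n :=
  \col_i \sum_(x : X | vtx x == i) (-1) ^ (deg x).

(** * Construction of cones and universal extensions *)

Section ConeConstruction.
Variables (n : nat) (Q : quiver n) (P X : cplx Q).
Local Notation A := (arrow Q).
Variable xi : mor A X P.
Hypothesis cxi : cocycle 1 xi.

Definition cone_shape : shape n :=
  @Shape n (P + X)%type
    (fun z => match z with inl p => vtx p | inr x => vtx x end)
    (fun z => match z with inl p => deg p | inr x => deg x end).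

Definition cone_inP : mor A P cone_shape :=
  lift0 A (fun p (z : cone_shape) => (inl p == z)%:R).
Definition cone_outP : mor A cone_shape P :=
  lift0 A (fun (z : cone_shape) p => (z == inl p)%:R).
Definition cone_inX : mor A X cone_shape :=
  lift0 A (fun x (z : cone_shape) => (inr x == z)%:R).
Definition cone_outX : mor A cone_shape X :=
  lift0 A (fun (z : cone_shape) x => (z == inr x)%:R).

Lemma eq_lift0 (T T' : finType) (M N : T -> T' -> 'F_2) :
  (forall x y, M x y = N x y) -> lift0 A M = lift0 A N.
Proof. by move=> e; apply/ffunP => -[[x y] o]; rewrite !ffunE e. Qed.

Lemma lift0_eq0 (T T' : finType) (M : T -> T' -> 'F_2) :
  (forall x y, M x y = 0) -> lift0 A M = 0.
Proof. by move=> e; apply/ffunP => -[[x y] o]; rewrite !ffunE e; case: o. Qed.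

Lemma cone_inP_outP : cone_inP ** cone_outP = idm A P.
Proof.
rewrite mcomp_lift0; apply: eq_lift0 => x y.
rewrite (bigD1 (inl x)) //= eqxx mul1r big1 ?addr0 // => z ne.
by rewrite eq_sym (negPf ne) mul0r.
Qed.

Lemma cone_inX_outX : cone_inX ** cone_outX = idm A X.
Proof.
rewrite mcomp_lift0; apply: eq_lift0 => x y.
rewrite (bigD1 (inr x)) //= eqxx mul1r big1 ?addr0 // => z ne.
by rewrite eq_sym (negPf ne) mul0r.
Qed.

Lemma cone_inP_outX : cone_inP ** cone_outX = 0.
Proof.
rewrite mcomp_lift0; apply: lift0_eq0 => x y.
rewrite (bigD1 (inl x)) //= mulr0 add0r big1 // => z ne.
by rewrite eq_sym (negPf ne) mul0r.
Qed.

Lemma cone_inX_outP : cone_inX ** cone_outP = 0.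
Proof.
rewrite mcomp_lift0; apply: lift0_eq0 => x y.
rewrite (bigD1 (inr x)) //= mulr0 add0r big1 // => z ne.
by rewrite eq_sym (negPf ne) mul0r.
Qed.

Lemma cone_out_in : cone_outP ** cone_inP + cone_outX ** cone_inX = idm A cone_shape.
Proof.
rewrite !mcomp_lift0; apply/ffunP => -[[z w] [a|]]; rewrite !ffunE //= ?addr0 //.
have z0 (b : 'F_2) : (false)%:R * b = 0 by rewrite mul0r.
case: z => z; [rewrite (bigD1 z) //= eqxx mul1r | rewrite addrC (bigD1 z) //= eqxx mul1r].
  rewrite big1 => [|y ne]; first by rewrite big1 ?addr0 // => y _; apply: z0.
  by rewrite (_ : (inl z == inl y) = false) ?z0 //; apply/eqP => -[e]; rewrite e eqxx in ne.
rewrite big1 => [|y ne]; first by rewrite big1 ?addr0 // => y _; apply: z0.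
by rewrite (_ : (inr z == inr y) = false) ?z0 //; apply/eqP => -[e]; rewrite e eqxx in ne.
Qed.

Definition cone_bd : mor A cone_shape cone_shape :=
  cone_outP ** (bd P ** cone_inP) + cone_outX ** (bd X ** cone_inX + xi ** cone_inP).

Lemma cone_iP_bd : cone_inP ** cone_bd = bd P ** cone_inP.
Proof. by rewrite mcompDr !mcompA cone_inP_outP cone_inP_outX mcomp1l !mcomp0l addr0. Qed.

Lemma cone_iX_bd : cone_inX ** cone_bd = bd X ** cone_inX + xi ** cone_inP.
Proof. by rewrite mcompDr !mcompA cone_inX_outP cone_inX_outX !mcomp0l mcomp1l add0r. Qed.

Lemma cone_bd_pP : cone_bd ** cone_outP = cone_outP ** bd P + cone_outX ** xi.
Proof.
by rewrite mcompDl -!mcompA cone_inP_outP mcomp1r mcompDl -!mcompA cone_inX_outP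
  cone_inP_outP mcomp0r add0r mcomp1r.
Qed.

Lemma cone_bd_pX : cone_bd ** cone_outX = cone_outX ** bd X.
Proof.
by rewrite mcompDl -!mcompA cone_inP_outX mcompDl -!mcompA cone_inX_outX
  cone_inP_outX !mcomp0r add0r addr0 mcomp1r.
Qed.

Lemma cone_bd_sq : cone_bd ** cone_bd = 0.
Proof.
have expand (b : mor A cone_shape cone_shape) :
    cone_bd ** b = cone_outP ** (bd P ** (cone_inP ** b))
      + cone_outX ** (bd X ** (cone_inX ** b) + xi ** (cone_inP ** b)).
  by rewrite !mcompDl -!mcompA mcompDl -!mcompA.
rewrite expand cone_iP_bd cone_iX_bd (mcompA (bd P)) bd_sq mcomp0l mcomp0r add0r.
rewrite (mcompDr (bd X)) (mcompA (bd X)) bd_sq mcomp0l add0r !mcompA -mcompDl.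
by move: cxi.2; rewrite difE => ->; rewrite mcomp0l mcomp0r.
Qed.

Lemma homog_iP : homog 0 cone_inP.
Proof.
by apply: homog_lift0 => x y; case: (eqVneq (inl x) y) => [<-|_]; rewrite ?eqxx // addr0.
Qed.

Lemma homog_pP : homog 0 cone_outP.
Proof.
by apply: homog_lift0 => x y; case: (eqVneq x (inl y)) => [->|_]; rewrite ?eqxx // addr0.
Qed.

Lemma homog_iX : homog 0 cone_inX.
Proof.
by apply: homog_lift0 => x y; case: (eqVneq (inr x) y) => [<-|_]; rewrite ?eqxx // addr0.
Qed.

Lemma homog_pX : homog 0 cone_outX.
Proof.
by apply: homog_lift0 => x y; case: (eqVneq x (inr y)) => [->|_]; rewrite ?eqxx // addr0.
Qed.

Lemma cone_bd_homog : homog 1 cone_bd.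
Proof.
apply: homogD; first apply: homog0l homog_pP (homog0r (@bd_homog _ _ P) homog_iP).
apply: homog0l homog_pX _; apply: homogD.
  exact: homog0r (@bd_homog _ _ X) homog_iX.
exact: homog0r cxi.1 homog_iP.
Qed.

Definition cone : cplx Q := Cplx cone_bd_homog cone_bd_sq.

Definition cone_is_cone : cone_of cone xi.
Proof.
apply: (@ConeOf _ _ P X cone xi cxi cone_inP cone_outP cone_inX cone_outX).
- exact: homog_iP.
- exact: homog_pP.
- exact: homog_iX.
- exact: homog_pX.
- exact: cone_inP_outP.
- exact: cone_inX_outX.
- exact: cone_inP_outX.
- exact: cone_inX_outP.
- exact: cone_out_in.
- by rewrite difE cone_iP_bd addff.
- by rewrite difE /= cone_bd_pX addff.
- by rewrite difE /= cone_bd_pP addrAC addff add0r.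
- by rewrite difE cone_iX_bd addKf.
Defined.

Lemma cls_cone : cls cone = cls X + cls P.
Proof.
apply/matrixP => i j; rewrite !mxE big_sumType addrC; congr (_ + _);
  by apply: eq_bigl => z.
Qed.

End ConeConstruction.

Section UniversalExtension.
Variables (n : nat) (Q : quiver n).
Local Notation A := (arrow Q).
Implicit Types X Y Z W P : cplx Q.

(* The last clause is the connecting map of the last cone, and is used to show that a
   cohomology group is concentrated in one degree. *)
Lemma universal_ext P X (S : pred int) :
  brick P -> (forall m : int, m != 0 -> acyclic_at m P P) ->
  (forall m : int, m <= 0 -> acyclic_at m X P) -> ~ acyclic_at 1 X P ->
  (forall x : P, S (deg x)) -> (forall x : X, S (deg x)) ->
  exists (Z : cplx Q) (phi : mor A Z X) (h : nat),
  [/\ ext_by P phi, forall m : int, m <= 1 -> acyclic_at m Z P, (0 < h)%N,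
      cls Z = cls X + cls P *+ h
    & (forall x : Z, S (deg x)) /\
      (forall W (m : int), acyclic_at m W P -> acyclic_at m W X ->
        acyclic_at (m + 1) W Z -> acyclic_at (m + 1) W P)].
Proof.
(* Each cone along a nonzero class of H^1(X, P) lowers the dimension of this group, so the process
   ends with H^1(Z, P) = 0. *)
move=> bP aP aX nX SP SX; have [k le] := ubnP (hdim X P 1).
elim: k => // k IH in X le aX nX SX *.
have /acyclicP/subvPn[xi /cocyclesP cxi nxi] := nX.
have nb : ~ bounds 1 xi by move/boundariesP; apply/negP.
pose Z := cone cxi; have c : cone_of Z xi := cone_is_cone cxi; have e := cone_ext c.
have lt : (hdim Z P 1 < hdim X P 1)%N by apply: (cone_hdim c) => //; apply: aP.
have aZ m : m <= 0 -> acyclic_at m Z P.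
  rewrite le_eqVlt => /orP[/eqP->|lt0]; first by apply: (cone_acyclic0 c bP _ nb); apply: aX.
  by apply: (ext_acyclic_pre e); [apply: aP; lia | apply: aX; lia].
have SZ (x : Z) : S (deg x) by case: x => x /=.
(* In the long exact sequence H^{m+1}(W, P) lies between H^m(W, X) and H^{m+1}(W, Z). *)
have base W m : acyclic_at m W X -> acyclic_at (m + 1) W Z -> acyclic_at (m + 1) W P.
  move=> aWX aWZ f cf; refine (@cone_iP_inj _ _ _ _ _ _ c _ _ _ _ cf _); first by rewrite addrK.
  by apply: aWZ; rewrite -[m + 1]addr0; apply: (cocycle_comp cf (cocycle_iP c)).
case: (boolP (cocycles Z P 1 <= boundaries Z P 1)%VS) => [/acyclicP a1|/acyclicP na].
  exists Z, (pX c), 1%N; split=> //.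
  - by move=> m; rewrite le_eqVlt => /orP[/eqP->//|lt1]; apply: aZ; lia.
  - by rewrite mulr1n cls_cone.
  - by split=> // W m _; apply: base.
have [|Z' [psi [h [e' a' h0 cl [S' b']]]]] := IH Z _ aZ na SZ; first by lia.
exists Z', (psi ** pX c), h.+1; split=> //; first exact: ext_comp e e'.
  by rewrite cl cls_cone mulrS addrA.
split=> // W m aWP aWX aWZ'; apply: b' => //.
exact: (ext_acyclic_post e).
Qed.

End UniversalExtension.

Lemma lift0_mcompl (A T T' T'' : finType) (M : T -> T' -> 'F_2) (f : mor A T' T'') x z o :
  (lift0 A M ** f) (x, z, o) = \sum_y M x y * f (y, z, o).
Proof.
rewrite ffunE /=; under eq_bigr do rewrite ffunE /=.
case: o => [a|]; last by rewrite addr0.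
by rewrite [X in _ + X]big1 ?addr0 // => y _; rewrite ffunE mul0r.
Qed.

Lemma lift0_mcompr (A T T' T'' : finType) (f : mor A T T') (M : T' -> T'' -> 'F_2) x z o :
  (f ** lift0 A M) (x, z, o) = \sum_y f (x, y, o) * M y z.
Proof.
rewrite ffunE /=; case: o => [a|].
  rewrite big1 ?add0r; last by move=> y _; rewrite ffunE mulr0.
  by apply: eq_bigr => y _; rewrite ffunE.
by rewrite addr0; apply: eq_bigr => y _; rewrite ffunE.
Qed.

(** * Minimal complexes *)

(* Gaussian elimination of an entry 1 of the differential; [pivot_pi] is the
   projection along the contractible summand spanned by [p] and [q]. *)
Section Cancellation.
Variables (n : nat) (Q : quiver n) (Z : cplx Q) (p q : Z).
Local Notation A := (arrow Q).
Hypothesis pq : bd Z (p, q, None) != 0.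

Lemma pivot_vtx : vtx p = vtx q.
Proof. by have /andP[/eqP] := bd_homog pq. Qed.

Lemma pivot_deg : deg q = deg p + 1.
Proof. by have /andP[_ /eqP] := bd_homog pq; rewrite addr0. Qed.

Lemma pivot_neq : p != q.
Proof. by apply/eqP => e; have := pivot_deg; rewrite e; lia. Qed.

Lemma pivot_entry o : bd Z (p, q, o) = (o == None)%:R.
Proof.
case: o => [a|]; last exact: F2_neq0.
apply/eqP/negPn/negP => /(@bd_homog _ _ Z)/andP[_ /eqP] /=.
by rewrite pivot_deg; lia.
Qed.

Definition kept : {pred Z} := [pred x | (x != p) && (x != q)].

Definition kept_shape : shape n :=
  @Shape n {x in kept} (fun x => vtx (val x)) (fun x => deg (val x)).

Definition kept_in : mor A kept_shape Z := lift0 A (fun (x : kept_shape) y => (val x == y)%:R).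
Definition kept_out : mor A Z kept_shape :=
  lift0 A (fun y (x : kept_shape) => (y == val x)%:R).
Definition pivot_h : mor A Z Z := lift0 A (fun x y => ((x == q) && (y == p))%:R).
(** A way back from p to q, so that [pivot_h ** pivot_h'] and [pivot_h' ** pivot_h] are the
    projections onto the lines of q and p. *)
Definition pivot_h' : mor A Z Z := lift0 A (fun x y => ((x == p) && (y == q))%:R).

Lemma sum_delta (T : finType) (a : T) (F : T -> 'F_2) : \sum_y (a == y)%:R * F y = F a.
Proof.
rewrite (bigD1 a) //= eqxx mul1r big1 ?addr0 // => y ne.
by rewrite eq_sym (negPf ne) mul0r.
Qed.

Lemma sum_delta' (T : finType) (a : T) (F : T -> 'F_2) : \sum_y F y * (y == a)%:R = F a.
Proof. by rewrite -[RHS]sum_delta; apply: eq_bigr => y _; rewrite mulrC eq_sym. Qed.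

Lemma boolF_mul (a b : bool) : (a && b)%:R = a%:R * b%:R :> 'F_2.
Proof. by case: a; case: b; rewrite ?mulr1 ?mul1r ?mulr0 ?mul0r. Qed.

Lemma pivot_hh : pivot_h ** pivot_h = 0.
Proof.
rewrite mcomp_lift0; apply: lift0_eq0 => x y; apply: big1 => z _.
have [->|] := eqVneq z p; last by rewrite andbF mul0r.
by rewrite (negPf pivot_neq) mulr0.
Qed.

Lemma kept_in_h : kept_in ** pivot_h = 0.
Proof.
rewrite mcomp_lift0; apply: lift0_eq0 => x y; rewrite sum_delta.
by have /andP[_ /negPf->] := valP x.
Qed.

Lemma h_kept_out : pivot_h ** kept_out = 0.
Proof.
rewrite mcomp_lift0; apply: lift0_eq0 => x y; rewrite sum_delta'.
by have /andP[/negPf-> _] := valP y; rewrite andbF.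
Qed.

Lemma kept_in_out : kept_in ** kept_out = idm A kept_shape.
Proof. by rewrite mcomp_lift0; apply: eq_lift0 => x y; rewrite sum_delta. Qed.

Lemma kept_out_in : kept_out ** kept_in = idm A Z + pivot_h ** pivot_h' + pivot_h' ** pivot_h.
Proof.
have hk : pivot_h ** pivot_h' = lift0 A (fun x y : Z => ((x == q) && (y == q))%:R).
  rewrite mcomp_lift0; apply: eq_lift0 => x y.
  under eq_bigr do rewrite !boolF_mul -mulrA.
  by rewrite -mulr_sumr; under eq_bigr do rewrite mulrA -boolF_mul andbb eq_sym;
     rewrite sum_delta -boolF_mul.
have kh : pivot_h' ** pivot_h = lift0 A (fun x y : Z => ((x == p) && (y == p))%:R).
  rewrite mcomp_lift0; apply: eq_lift0 => x y.
  under eq_bigr do rewrite !boolF_mul -mulrA.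
  by rewrite -mulr_sumr; under eq_bigr do rewrite mulrA -boolF_mul andbb eq_sym;
     rewrite sum_delta -boolF_mul.
rewrite hk kh mcomp_lift0; apply/ffunP => -[[x y] [a|]]; rewrite !ffunE /= ?addr0 //.
under eq_bigr do rewrite -boolF_mul.
rewrite -(@big_sub _ _ _ Z kept (fun z => ((x == z) && (z == y))%:R)).
have pnq := pivot_neq.
have [kx|/norP] := boolP ((x == p) || (x == q)).
  rewrite big1 => [|z /andP[zp zq]]; last first.
    by case: eqP => [e|//]; move: kx zp zq; rewrite e => /orP[] ->.
  case/orP: kx => /eqP->.
    by rewrite eqxx (negPf pnq) /= addr0 [y == p]eq_sym addff.
  by rewrite eqxx [q == p]eq_sym (negPf pnq) /= addr0 [y == q]eq_sym addff.
move=> [xp xq]; rewrite (bigD1 x) /=; last by rewrite inE xp xq.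
rewrite eqxx /= big1 ?addr0 => [|z /andP[_ zx]]; last by rewrite eq_sym (negPf zx).
by rewrite (negPf xp) (negPf xq) !addr0.
Qed.

(** The only entry of the differential between the two factors is the pivot, and over F_2 a nonzero
    pivot is 1. *)
Lemma pivot_hdh : pivot_h ** bd Z ** pivot_h = pivot_h.
Proof.
apply/ffunP => -[[x y] o]; rewrite lift0_mcompr.
under eq_bigr do rewrite boolF_mul mulrA mulrAC.
rewrite sum_delta' lift0_mcompl.
under eq_bigr do rewrite boolF_mul mulrAC.
rewrite sum_delta' pivot_entry ffunE /=; case: o => [a|] /=.
  by rewrite mulr0 mul0r.
by rewrite mulr1 -boolF_mul.
Qed.

Local Notation D := (bd Z).
Definition pivot_pi : mor A Z Z := idm A Z + D ** pivot_h + pivot_h ** D.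

Lemma pi_h : pivot_pi ** pivot_h = 0.
Proof.
by rewrite !mcompDl pivot_hdh -mcompA pivot_hh mcomp0r addr0 mcomp1l addff.
Qed.

Lemma h_pi : pivot_h ** pivot_pi = 0.
Proof.
by rewrite !mcompDr !mcompA pivot_hdh pivot_hh mcomp0l addr0 mcomp1r addff.
Qed.

Lemma pi_d : pivot_pi ** D = D ** pivot_pi.
Proof.
rewrite !mcompDl !mcompDr mcomp1l mcomp1r -(mcompA pivot_h) bd_sq mcomp0r addr0.
by rewrite !mcompA bd_sq mcomp0l addr0.
Qed.

Lemma pi_pi : pivot_pi ** pivot_pi = pivot_pi.
Proof.
rewrite {1}/pivot_pi !mcompDl mcomp1l -!mcompA -pi_d h_pi mcomp0r addr0.
by rewrite mcompA h_pi mcomp0l addr0.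
Qed.

(** Leaving out p and q costs nothing here: the correction terms of [kept_out_in] contain [pivot_h],
    which [pivot_pi] kills on both sides. *)
Lemma pi_out_in_pi : pivot_pi ** kept_out ** kept_in ** pivot_pi = pivot_pi.
Proof.
have expand (b c : mor A Z Z) : b ** (idm A Z + pivot_h ** pivot_h' + pivot_h' ** pivot_h) ** c =
    b ** c + b ** pivot_h ** pivot_h' ** c + b ** pivot_h' ** (pivot_h ** c).
  by rewrite !mcompDr !mcompDl mcomp1r !mcompA.
rewrite -(mcompA pivot_pi kept_out) kept_out_in expand pi_pi pi_h h_pi.
by rewrite !mcomp0l mcomp0r !addr0.
Qed.

Lemma in_pi_out : kept_in ** pivot_pi ** kept_out = idm A kept_shape.
Proof.
rewrite !mcompDr !mcompDl mcomp1r kept_in_out (mcompA kept_in pivot_h) kept_in_h !mcomp0l addr0.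
by rewrite -!mcompA h_kept_out !mcomp0r addr0.
Qed.

Definition kept_bd : mor A kept_shape kept_shape :=
  kept_in ** pivot_pi ** D ** pivot_pi ** kept_out.

Lemma kept_bd_sq : kept_bd ** kept_bd = 0.
Proof.
have -> : kept_bd ** kept_bd =
    kept_in ** pivot_pi ** D ** (pivot_pi ** kept_out ** kept_in ** pivot_pi)
    ** D ** pivot_pi ** kept_out.
  by rewrite /kept_bd !mcompA.
rewrite pi_out_in_pi -(mcompA (kept_in ** pivot_pi) D pivot_pi) -pi_d !mcompA.
rewrite -(mcompA _ D D) bd_sq.
by rewrite mcomp0r !mcomp0l.
Qed.

Lemma homog_in : homog 0 kept_in.
Proof.
by apply: homog_lift0 => x y; case: (eqVneq (val x) y) => [<-|_]; rewrite ?eqxx // addr0.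
Qed.

Lemma homog_out : homog 0 kept_out.
Proof.
by apply: homog_lift0 => x y; case: (eqVneq x (val y)) => [->|_]; rewrite ?eqxx // addr0.
Qed.

Lemma homog_h : homog (- 1) pivot_h.
Proof.
apply: homog_lift0 => x y; case: (eqVneq x q) => [->|_]; rewrite ?eqxx //.
case: (eqVneq y p) => [->|_]; rewrite ?eqxx // pivot_vtx pivot_deg => _.
by split=> //; lia.
Qed.

Lemma homog_pi : homog 0 pivot_pi.
Proof.
apply: homogD; first apply: homogD.
- exact: homog_id.
- by rewrite -[0](subrr 1); apply: homog_comp homog_h; apply: bd_homog.
- by rewrite -[0](addNr 1); apply: homog_comp homog_h _; apply: bd_homog.
Qed.

Lemma kept_bd_homog : homog 1 kept_bd.
Proof.
apply: homog0r homog_out; apply: homog0r homog_pi.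
exact: homog0l (homog0r homog_in homog_pi) (@bd_homog _ _ Z).
Qed.

Definition kept_cplx : cplx Q := Cplx kept_bd_homog kept_bd_sq.

(** This is a homotopy equivalence with inverse [pivot_pi ** kept_out] and homotopy [pivot_h], hence
    an extension by no copies of P, whatever P is. *)
Lemma kept_ext P : ext_by P (kept_in ** pivot_pi : mor A kept_cplx Z).
Proof.
apply: (@heq_ext n Q P Z kept_cplx (kept_in ** pivot_pi) (pivot_pi ** kept_out)).
- split; first exact: homog0r homog_in homog_pi.
  rewrite difE /= /kept_bd -!mcompA (mcompA kept_out) (mcompA pivot_pi (kept_out ** _)).
  by rewrite (mcompA pivot_pi kept_out) pi_out_in_pi pi_d (mcompA pivot_pi D) pi_d -mcompA pi_pi addff.
- split; first exact: homog0r homog_pi homog_out.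
  rewrite difE /= /kept_bd !mcompA pi_out_in_pi pi_d.
  by rewrite -(mcompA D pivot_pi pivot_pi) pi_pi addff.
- have -> : kept_in ** pivot_pi ** (pivot_pi ** kept_out) = idm A kept_shape.
    by rewrite mcompA -(mcompA _ pivot_pi pivot_pi) pi_pi in_pi_out.
  by rewrite addff; apply: bounds0.
- have -> : pivot_pi ** kept_out ** (kept_in ** pivot_pi) = pivot_pi by rewrite mcompA pi_out_in_pi.
  exists pivot_h; first exact: homog_h.
  by rewrite difE /pivot_pi [LHS]addrC !addrA addff add0r.
Qed.

Lemma cls_kept : cls kept_cplx = cls Z.
Proof.
apply/matrixP => i j; rewrite !mxE.
rewrite -(@big_sub_cond _ _ _ Z kept (fun x => vtx x == i) (fun x => (-1) ^ deg x)).
rewrite big_mkcond [RHS]big_mkcond /= [RHS](bigD1 p) //= [X in _ + X](bigD1 q) /=; last first.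
  by rewrite eq_sym pivot_neq.
rewrite addrA pivot_vtx pivot_deg exprzDr // expr1z mulrN1.
rewrite [X in X + _](_ : _ = 0) ?add0r; last by case: ifP; rewrite ?subrr ?addr0.
rewrite [RHS]big_mkcond; apply: eq_bigr => x _; rewrite !inE.
by case: (x == p); case: (x == q); rewrite ?andbF.
Qed.

Lemma card_kept : (#|kept_cplx| < #|Z|)%N.
Proof.
rewrite card_sig; apply: proper_card; apply/properP; split; first exact/subsetP.
by exists p; rewrite // !inE eqxx.
Qed.

End Cancellation.

(** * Stalk complexes and the Euler form *)

Definition stalk n (d : int) (X : shape n) := forall x : X, deg x = d.

Definition minimal n (Q : quiver n) (X : cplx Q) := forall x y : X, bd X (x, y, None) = 0.

Definition euler n (Q : quiver n) : 'M[int]_n :=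
  \matrix_(i, j) ((i == j)%:R - #|[pred a : arrow Q | (src a == i) && (tgt a == j)]|%:R).

Lemma formE n (M : 'M[int]_n) u v :
  form M u v = \sum_i \sum_j u i 0 * M i j * v j 0.
Proof.
rewrite /form -mulmxA mxE; apply: eq_bigr => i _; rewrite !mxE mulr_sumr.
by apply: eq_bigr => j _; rewrite mulrA.
Qed.

Lemma sign_exprzN (a : int) : (-1) ^ (- a) = (-1) ^ a :> int.
Proof. by rewrite -exprz_inv. Qed.

Lemma big_option (A : finType) (F : option A -> nat) :
  (\sum_o F o = F None + \sum_a F (Some a))%N.
Proof. by rewrite ![index_enum _]unlock [@Finite.enum in LHS]unlock /= big_cons big_map. Qed.

Section Minimal.
Variables (n : nat) (Q : quiver n).
Local Notation A := (arrow Q).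
Implicit Types X Y Z W P : cplx Q.

Lemma minimalize Z (S : pred int) : (forall x : Z, S (deg x)) ->
  exists (Z' : cplx Q) (phi : mor A Z' Z),
  [/\ forall P, ext_by P phi, minimal Z', cls Z' = cls Z & forall x : Z', S (deg x)].
Proof.
have [k] := ubnP #|Z|; elim: k => // k IH in Z * => le SZ.
case: (pickP (fun t : (Z * Z)%type => bd Z (t.1, t.2, None) != 0)) => [[p q] /= pq|no].
  have [||Z' [phi [e m c S']]] := IH (kept_cplx pq).
  - by have := card_kept pq; lia.
  - by move=> x; apply: SZ (val x).
  exists Z', (phi ** (kept_in p q ** pivot_pi p q)); split=> // [P|].
    exact: ext_comp (kept_ext pq P) (e P).
  by rewrite c cls_kept.
exists Z, (idm A Z); split=> // [P|x y]; first exact: ext_id.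
by apply/eqP/negbFE; apply: (no (x, y)).
Qed.

Definition zero_shape : shape n := @Shape n void (fun x => match x with end) (fun x => match x with end).

Lemma zero_bd_homog : @homog n Q zero_shape zero_shape 1 0.
Proof. by case=> [[[]]]. Qed.

(** Used as P in [ext_by], it discharges all side conditions, so that vanishing passes freely along
    a minimal model. *)
Definition zero_cplx : cplx Q := Cplx zero_bd_homog (mcomp0l _ _).

Lemma acyclic_zerol m X : acyclic_at m zero_cplx X.
Proof.
by move=> f _; suff -> : f = 0 by [apply: bounds0]; apply/ffunP => -[[[]]].
Qed.

Lemma acyclic_zeror m X : acyclic_at m X zero_cplx.
Proof.
by move=> f _; suff -> : f = 0 by [apply: bounds0]; apply/ffunP => -[[? []]].
Qed.

(* Without differential, the projections onto the homogeneous parts are cocycles. *)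
Lemma minimal_brick_stalk X : minimal X -> brick X -> exists2 x0 : X, True & stalk (deg x0) X.
Proof.
move=> mX [nid bX].
have [x0 _|no] := pickP (fun x : X => true); last first.
  case: nid; suff -> : idm A X = 0 by apply: bounds0.
  by apply/ffunP => -[[x y] o]; have := no x.
exists x0 => //.
pose e : mor A X X := lift0 A (fun x y => ((x == y) && (deg x == deg x0))%:R).
have ce : cocycle 0 e.
  split.
    apply: homog_lift0 => x y; case: (eqVneq x y) => [->|_]; last by rewrite eqxx.
    by rewrite addr0.
  apply/ffunP => -[[x y] o].
  have l f : (e ** f) (x, y, o) = (deg x == deg x0)%:R * f (x, y, o).
    rewrite lift0_mcompl (bigD1 x) //= eqxx big1 ?addr0 // => z ne.
    by rewrite eq_sym (negPf ne) mul0r.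
  have r f : (f ** e) (x, y, o) = f (x, y, o) * (deg y == deg x0)%:R.
    rewrite lift0_mcompr (bigD1 y) //= eqxx big1 ?addr0 // => z ne.
    by rewrite (negPf ne) mulr0.
  rewrite difE [LHS]ffunE l r [RHS]ffunE.
  have [->|n0] := eqVneq (bd X (x, y, o)) 0; first by rewrite mul0r mulr0 addr0.
  case: o l r n0 => [a _ _|_ _]; last by rewrite mX eqxx.
  move/(@bd_homog _ _ X)/andP => -[_ /eqP/addIr ->].
  by rewrite mulrC addff.
(* In a minimal complex boundaries have no scalar part. Hence [e], which is 1 at [x0], does not
   bound, and [e + idm] can bound only if every basis element has the degree of [x0]. *)
have bnd0 (f : mor A X X) x y : bounds 0 f -> f (x, y, None) = 0.
  case=> h _ ->; rewrite difE !ffunE /= !addr0 !big1 ?addr0 // => z _.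
    by rewrite mX mulr0.
  by rewrite mX mul0r.
case: (bX _ ce) => b x.
  by have := bnd0 _ x0 x0 b; rewrite ffunE /= !eqxx => /eqP.
have := bnd0 _ x x b; rewrite !ffunE /= !eqxx /=.
by case: eqP => // _; rewrite add0r => /eqP.
Qed.

Lemma acyclic_hdim X Y m : acyclic_at m X Y <-> hdim X Y m = 0%N.
Proof.
rewrite /hdim; split=> [/acyclicP/dimvS/eqP //|/eqP h].
apply/acyclicP; suff /eqP -> : boundaries X Y m == cocycles X Y m by [].
by rewrite eqEdim boundaries_sub.
Qed.

Lemma brick_hdim X : brick X -> hdim X X 0 = 1%N.
Proof.
case=> nid bX.
have -> : hdim X X 0 = (\dim (boundaries X X 0 + <[idm A X : mor A X X]>) - \dim (boundaries X X 0))%N.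
  congr (\dim _ - _)%N; apply/eqP; rewrite eqEsubv; apply/andP; split; last first.
    rewrite subv_add boundaries_sub -memvE; exact/cocyclesP/cocycle_id.
  apply/subvP => f /cocyclesP/bX[b|b]; first by rewrite -[f]addr0; apply: memv_add (mem0v _); apply/boundariesP.
  rewrite -[f](addfK _ (idm A X)); apply: memv_add (memv_line _); exact/boundariesP.
rewrite dimv_disjoint_sum ?addKn; last first.
  apply/eqP; rewrite -subv0; apply/subvP => f; rewrite memv_cap memv0 => /andP[b /vlineP[c e]].
  move: b; rewrite e; have [->|/F2_neq0->] := eqVneq c 0; first by rewrite scale0r.
  by rewrite scale1r => /boundariesP.
rewrite dim_vline; case: eqP => // e; case: nid; rewrite e; exact: bounds0.
Qed.

Section Stalks.
Variables (X Y : cplx Q) (a b : int).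
Hypotheses (sX : stalk a X) (sY : stalk b Y).

Lemma homog_stalk m (f : mor A X Y) :
  homog m f -> m != b - a -> m != b - a + 1 -> f = 0.
Proof.
move=> h n0 n1; apply/ffunP => t; rewrite [RHS]ffunE; apply/eqP/negPn/negP => /h/andP[_].
rewrite sX sY; case: (t.2) => [c|] /= /eqP e; first by move: n1; rewrite (_ : m = b - a + 1) ?eqxx //; lia.
by move: n0; rewrite (_ : m = b - a) ?eqxx //; lia.
Qed.

(** The two remaining degrees carry Hom and Ext^1 of the underlying representations; over a
    hereditary algebra there is nothing else. *)
Lemma acyclic_stalk m : m != b - a -> m != b - a + 1 -> acyclic_at m X Y.
Proof. by move=> n0 n1 f [/homog_stalk h _]; rewrite h //; apply: bounds0. Qed.

Lemma homog_space_stalk m : m != b - a -> m != b - a + 1 -> homog_space Q X Y m = 0%VS.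
Proof.
move=> n0 n1; apply/eqP; rewrite -subv0; apply/subvP => f /homog_spaceP/homog_stalk.
by rewrite memv0 => ->.
Qed.

Lemma card_allowed (F : X -> Y -> option A -> bool) :
  #|[pred t : (X * Y * option A)%type | F t.1.1 t.1.2 t.2]| =
  (\sum_(x : X) \sum_(y : Y) (F x y None + #|[pred c : A | F x y (Some c)]|))%N.
Proof.
rewrite -sum1_card big_mkcond /= -(pair_bigA _ (fun xy o => if F xy.1 xy.2 o then 1 else 0)%N).
rewrite -(pair_bigA _ (fun x y => \sum_o (if F x y o then 1 else 0))%N) /=.
apply: eq_bigr => x _; apply: eq_bigr => y _; rewrite big_option -sum1_card [in RHS]big_mkcond.
by case: (F x y None).
Qed.

Lemma form_cls :
  form (euler Q) (cls X) (cls Y) = (-1) ^ (b - a) *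
    (\sum_(x : X) \sum_(y : Y) euler Q (vtx x) (vtx y)).
Proof.
have clsX (Z : shape n) d (sZ : stalk d Z) i :
    cls Z i 0 = (-1) ^ d * \sum_(z : Z) (i == vtx z)%:R.
  rewrite mxE mulr_sumr big_mkcond; apply: eq_bigr => z _.
  by rewrite sZ eq_sym; case: eqP; rewrite ?mulr1 ?mulr0.
have sel (Z : shape n) (F : 'I_n -> int) :
    \sum_i (\sum_(z : Z) (i == vtx z)%:R) * F i = \sum_(z : Z) F (vtx z).
  under eq_bigr do rewrite mulr_suml.
  rewrite exchange_big; apply: eq_bigr => z _ /=.
  rewrite (bigD1 (vtx z)) //= eqxx mul1r big1 ?addr0 // => i ne.
  by rewrite (negPf ne) mul0r.
rewrite formE.
under eq_bigr do under eq_bigr do rewrite (clsX _ _ sX) (clsX _ _ sY).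
transitivity (\sum_i \sum_j (\sum_(x : X) (i == vtx x)%:R) * ((-1) ^ (b - a) *
    ((\sum_(y : Y) (j == vtx y)%:R) * euler Q i j))).
  apply: eq_bigr => i _; apply: eq_bigr => j _; rewrite [b - a]addrC exprzDr //.
  by rewrite sign_exprzN; ring.
under eq_bigr do rewrite -mulr_sumr -mulr_sumr sel.
rewrite sel mulr_sumr.
by [].
Qed.

(** The complex of homogeneous morphisms has two terms, spanned by pairs of basis elements at the
    same vertex and by pairs joined by an arrow. Its Euler characteristic can be computed before or
    after taking cohomology. *)
Lemma euler_formula :
  form (euler Q) (cls X) (cls Y) =
  (-1) ^ (b - a) * ((hdim X Y (b - a))%:R - (hdim X Y (b - a + 1))%:R).
Proof.
have d0 : \dim (homog_space Q X Y (b - a)) =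
    (\sum_(x : X) \sum_(y : Y) (vtx x == vtx y))%N.
  rewrite dim_homog_space (card_allowed (fun x y o => @allowed _ _ X Y (b - a) (x, y, o))).
  apply: eq_bigr => x _; apply: eq_bigr => y _; rewrite /allowed /= sX sY.
  rewrite addr0 addrC subrK eqxx andbT eq_card0 ?addn0 // => c.
  by rewrite inE; apply/negP => /andP[_ /eqP]; lia.
have d1 : \dim (homog_space Q X Y (b - a + 1)) =
    (\sum_(x : X) \sum_(y : Y) #|[pred c : A | (src c == vtx x) && (tgt c == vtx y)]|)%N.
  rewrite dim_homog_space (card_allowed (fun x y o => @allowed _ _ X Y (b - a + 1) (x, y, o))).
  apply: eq_bigr => x _; apply: eq_bigr => y _; rewrite /allowed /= sX sY.
  rewrite [X in (X + _)%N](_ : _ = 0%N) ?add0n.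
    by apply: eq_card => c; rewrite !inE; rewrite [X in _ && X](_ : _ = true) ?andbT //; apply/eqP; lia.
  by rewrite [X in _ && X](_ : _ = false) ?andbF //; apply/eqP; lia.
have z1 : cocycles X Y (b - a + 1) = homog_space Q X Y (b - a + 1).
  apply/vspaceP => f; apply/cocyclesP/homog_spaceP => [[]//|h]; split=> //.
  apply: (homog_stalk (homog_dif h)); apply/eqP; lia.
have b0 : boundaries X Y (b - a) = 0%VS.
  by rewrite /boundaries homog_space_stalk ?limg0 //; apply/eqP; lia.
have := limg_ker_dim (linfun (@dif n Q X Y)) (homog_space Q X Y (b - a)).
rewrite -/(cocycles X Y (b - a)) form_cls => e.
have -> : \sum_(x : X) \sum_(y : Y) euler Q (vtx x) (vtx y) =
    (\dim (homog_space Q X Y (b - a)))%:R - (\dim (homog_space Q X Y (b - a + 1)))%:R.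
  rewrite d0 d1 !natr_sum -sumrB; apply: eq_bigr => x _.
  rewrite !natr_sum -sumrB; apply: eq_bigr => y _.
  by rewrite mxE.
congr (_ * _); rewrite /hdim b0 dimv0 subn0 z1 -e /boundaries addrK natrD natrB.
  by rewrite opprB addrA.
rewrite -z1; have := dimvS (boundaries_sub X Y (b - a + 1)).
by rewrite /boundaries addrK.
Qed.

End Stalks.
End Minimal.

(** * Bilinear forms and the shift *)

Section Form.
Variables (n : nat) (M : 'M[int]_n).
Implicit Types u v w : 'cV[int]_n.

Lemma formDl u v w : form M (u + v) w = form M u w + form M v w.
Proof. by rewrite /form raddfD /= !mulmxDl mxE. Qed.

Lemma formDr u v w : form M u (v + w) = form M u v + form M u w.
Proof. by rewrite /form mulmxDr mxE. Qed.

Lemma formZl a u v : form M (a *: u) v = a * form M u v.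
Proof. by rewrite /form linearZ /= -!scalemxAl mxE. Qed.

Lemma formZr a u v : form M u (a *: v) = a * form M u v.
Proof. by rewrite /form -scalemxAr mxE. Qed.

Lemma formNl u v : form M (- u) v = - form M u v.
Proof. by rewrite -scaleN1r formZl mulN1r. Qed.

Lemma formNr u v : form M u (- v) = - form M u v.
Proof. by rewrite -scaleN1r formZr mulN1r. Qed.

Lemma form_tr u v : form M^T u v = form M v u.
Proof.
rewrite !formE exchange_big; apply: eq_bigr => i _; apply: eq_bigr => j _.
by rewrite mxE; ring.
Qed.

End Form.

Section Shift.
Variables (n : nat) (Q : quiver n).
Local Notation A := (arrow Q).
Implicit Types X Y Z W P : cplx Q.

Definition shift_shape (X : shape n) : shape n := @Shape n X (@vtx n X) (fun x => deg x - 1).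

Lemma homog_shift (X Y : shape n) m (f : mor A X Y) :
  @homog n Q X Y m f -> @homog n Q (shift_shape X) (shift_shape Y) m f.
Proof.
move=> h t /h; rewrite /allowed => /andP[c /eqP e]; apply/andP; split=> //.
by apply/eqP; move: e => /=; lia.
Qed.

Definition shift P : cplx Q :=
  @Cplx n Q (shift_shape P) (bd P) (homog_shift (@bd_homog n Q P)) (bd_sq P).

Lemma homog_shiftr (X Y : shape n) m (f : mor A X Y) :
  @homog n Q X (shift_shape Y) m f <-> @homog n Q X Y (m + 1) f.
Proof.
by split=> h t /h; rewrite /allowed => /andP[c /eqP e]; apply/andP; split=> //;
  apply/eqP; move: e => /=; lia.
Qed.

Lemma homog_shiftl (X Y : shape n) m (f : mor A X Y) :
  @homog n Q (shift_shape X) Y m f <-> @homog n Q X Y (m - 1) f.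
Proof.
by split=> h t /h; rewrite /allowed => /andP[c /eqP e]; apply/andP; split=> //;
  apply/eqP; move: e => /=; lia.
Qed.

Lemma acyclic_shiftr X P m : acyclic_at (m + 1) X P -> acyclic_at m X (shift P).
Proof.
move=> a f [/homog_shiftr hf df].
have [|h hh e] := a f; first by split=> //; move: df; rewrite !difE.
exists h; last by rewrite [LHS]e !difE.
by apply/homog_shiftr; rewrite addrAC.
Qed.

Lemma acyclic_shiftl X P m : acyclic_at (m - 1) P X -> acyclic_at m (shift P) X.
Proof.
move=> a f [/homog_shiftl hf df].
have [|h hh e] := a f; first by split=> //; move: df; rewrite !difE.
exists h; last by rewrite [LHS]e !difE.
by apply/homog_shiftl.
Qed.

Lemma brick_shift P : brick P -> brick (shift P).
Proof.
have hs m (f : mor A P P) :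
    @homog n Q (shift_shape P) (shift_shape P) m f <-> @homog n Q P P m f.
  by split=> h; [rewrite -[m](subrK 1); apply/homog_shiftr/homog_shiftl/h
               | apply: homog_shift].
have bs (f : mor A P P) : @bounds n Q (shift P) (shift P) 0 f <-> @bounds n Q P P 0 f.
  by split=> -[h /hs hh e]; exists h; rewrite ?e ?difE //; apply/hs.
case=> nid bP; split; first by move/bs.
move=> f [/hs hf df].
by case: (bP f) => [|/bs|/bs]; [split=> //; move: df; rewrite !difE | left | right].
Qed.

Lemma cls_shift P : cls (shift P) = - cls P.
Proof.
apply/matrixP => i j; rewrite !mxE -sumrN; apply: eq_bigr => x _ /=.
by rewrite exprzDr // mulrN1.
Qed.

End Shift.

(** * Mutation of frames *)

Definition stalk_deg (b : bool) : int := if b then 0 else -1.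

(** [frame_norm] is the numerical form of rigidity, see [frame_rigid]. The rank [r] expresses that E
    is unitriangular in a suitable order of the indices. *)
Record frame n (Q : quiver n) (c : 'I_n -> 'cV[int]_n) (pos : 'I_n -> bool)
    (X : 'I_n -> cplx Q) (r : 'I_n -> nat) : Prop := Frame {
  frame_stalk : forall i, stalk (stalk_deg (pos i)) (X i);
  frame_cls : forall i, cls (X i) = c i;
  frame_brick : forall i, brick (X i);
  frame_hom : forall i j (m : int), i != j -> m <= 0 -> acyclic_at m (X i) (X j);
  frame_norm : forall i, form (euler Q) (c i) (c i) = 1;
  frame_order : forall i j, i != j -> form (euler Q) (c i) (c j) != 0 -> (r i < r j)%N }.

Arguments frame_stalk {n Q c pos X r} _ i x.
Arguments frame_brick {n Q c pos X r} _ i.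
Arguments frame_hom {n Q c pos X r} _ i j m _ _ _ _.
Arguments frame_order {n Q c pos X r} _ i j _ _.

Definition framed n (Q : quiver n) (c : 'I_n -> 'cV[int]_n) (pos : 'I_n -> bool) :=
  exists X r, @frame n Q c pos X r.

Section FrameTheory.
Variables (n : nat) (Q : quiver n) (c : 'I_n -> 'cV[int]_n) (pos : 'I_n -> bool).
Variables (X : 'I_n -> cplx Q) (r : 'I_n -> nat).
Hypothesis F : frame c pos X r.
Local Notation A := (arrow Q).
Local Notation e i j := (form (euler Q) (c i) (c j)).
Local Notation H m i j := (hdim (X i) (X j) m).

Lemma frame_same i j : pos i = pos j -> e i j = (H 0 i j)%:R - (H 1 i j)%:R.
Proof.
move=> p; rewrite -!(frame_cls F) (euler_formula (frame_stalk F i) (frame_stalk F j)).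
by rewrite p subrr mul1r add0r.
Qed.

Lemma frame_same_neq i j : i != j -> pos i = pos j -> e i j = - (H 1 i j)%:R.
Proof.
move=> ij p; rewrite (frame_same p) (acyclic_hdim _ _ _).1 ?sub0r //.
exact: (frame_hom F).
Qed.

(** Between stalks in degrees -1 and 0, H^1 is Hom and H^2 is Ext^1. *)
Lemma frame_np i j : ~~ pos i -> pos j -> e i j = (H 2 i j)%:R - (H 1 i j)%:R.
Proof.
move=> pi pj; rewrite -!(frame_cls F) (euler_formula (frame_stalk F i) (frame_stalk F j)).
by rewrite (negPf pi) pj /= opprK add0r expr1z mulN1r opprB.
Qed.

(** From degree 0 to degree -1 cohomology could live only in degrees -1 and 0, where [frame_hom]
    excludes it. *)
Lemma frame_pn_acyclic i j m : pos i -> ~~ pos j -> acyclic_at m (X i) (X j).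
Proof.
move=> pi pj; have ij : i != j by apply/eqP => ij; rewrite -ij pi in pj.
have [m0|m0] := leP m 0; first exact: (frame_hom F).
apply: (acyclic_stalk (frame_stalk F i) (frame_stalk F j));
  rewrite pi (negPf pj) /=; apply/eqP; lia.
Qed.

Lemma frame_pn i j : pos i -> ~~ pos j -> e i j = 0.
Proof.
move=> pi pj; rewrite -!(frame_cls F) (euler_formula (frame_stalk F i) (frame_stalk F j)).
by rewrite !(acyclic_hdim _ _ _).1 ?subrr ?mulr0 //; apply: frame_pn_acyclic.
Qed.

(** The norm 1 equals dim H^0 - dim H^1, and a brick has dim H^0 = 1. *)
Lemma frame_rigid i m : m != 0 -> acyclic_at m (X i) (X i).
Proof.
move=> m0; have [->|m1] := eqVneq m 1.
  apply/acyclic_hdim; have := frame_norm F i; rewrite frame_same //.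
  by rewrite (brick_hdim (frame_brick F i)); lia.
by apply: (acyclic_stalk (frame_stalk F i) (frame_stalk F i)); rewrite subrr.
Qed.

Lemma frame_antisym i j : i != j -> e i j != 0 -> e j i = 0.
Proof.
move=> ij eij; apply/eqP/negPn/negP => eji.
have := frame_order F _ _ ij eij; rewrite eq_sym in ij.
by have := frame_order F _ _ ij eji; lia.
Qed.

Variable k : 'I_n.
Hypothesis pk : pos k.

(* [Y] is a minimal model of the universal extension of [X i] by [h] copies of [X k]. *)
Definition mutated i (Y : cplx Q) (h : nat) (b : bool) :=
  exists phi : mor A Y (X i),
  [/\ ext_by (X k) phi, forall m : int, m <= 1 -> acyclic_at m Y (X k),
      brick Y /\ stalk (stalk_deg b) Y, cls Y = c i + c k *+ h
    & if h is 0 then Y = X i /\ b = pos i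
      else forall W (m : int), acyclic_at m W (X k) -> acyclic_at m W (X i) ->
        acyclic_at (m + 1) W Y -> acyclic_at (m + 1) W (X k)].

Lemma mutated_exists i : i != k ->
  exists t : (cplx Q * nat * bool)%type, mutated i t.1.1 t.1.2 t.2.
Proof.
move=> ik.
have ki : k != i by rewrite eq_sym.
have [a1|na1] := boolP (cocycles (X i) (X k) 1 <= boundaries (X i) (X k) 1)%VS.
  exists (X i, 0%N, pos i) => /=; exists (idm A (X i)); split.
  - exact: ext_id.
  - move=> m; rewrite le_eqVlt => /orP[/eqP->|m1]; first exact/acyclicP.
    by apply: (frame_hom F) => //; lia.
  - by split; [apply: (frame_brick F) | apply: (frame_stalk F)].
  - by rewrite (frame_cls F) mulr0n addr0.
  - by [].
(* The extension and its minimal model keep to these two degrees, so the stalk obtained below has a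
   sign. *)
pose S : pred int := fun d => (d == 0) || (d == -1).
have Sk (x : X k) : S (deg x) by rewrite (frame_stalk F) pk.
have Si (x : X i) : S (deg x).
  by rewrite (frame_stalk F) /S; case: (pos i).
have [|Z [phi [h [eZ aZ h0 cZ [SZ bZ]]]]] := universal_ext (frame_brick F k)
  (@frame_rigid k) (fun m => frame_hom F i k m ik) _ Sk Si.
  by move/acyclicP; apply/negP.
have [Y [psi [eY mY cY SY]]] := minimalize SZ.
have ext := ext_comp eZ (eY (X k)).
have aY m : m <= 1 -> acyclic_at m Y (X k).
  by move=> m1; apply: (ext_acyclic_pre (eY (zero_cplx Q)));
     [apply: acyclic_zerol | apply: aZ].
have bY : brick Y.
  apply: (ext_brick ext) (frame_brick F i); try exact: aY.
    exact: (frame_hom F).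
  exact: (frame_hom F).
have [y0 _ sY] := minimal_brick_stalk mY bY.
exists (Y, h, deg y0 == 0) => /=; exists (psi ** phi); split=> //.
- split=> //; move: (SY y0); rewrite /stalk_deg /S => /orP[/eqP d0|/eqP d1] y;
    by rewrite sY ?d0 ?d1.
- by rewrite cY cZ !(frame_cls F).
- case: h h0 {cZ} => // h _ W m aW aWi aWY; apply: bZ => //.
  by apply: (ext_acyclic_post' (eY (zero_cplx Q))) => //; apply: acyclic_zeror.
Qed.
End FrameTheory.

(** * The order after a mutation *)

Section MutatedOrder.
Variables (n : nat) (k : 'I_n) (e : 'I_n -> 'I_n -> int) (pos b : 'I_n -> bool).
Variables (h r : 'I_n -> nat).
Hypothesis pk : pos k.
Hypothesis ord : forall x y, x != y -> e x y != 0 -> (r x < r y)%N.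
Hypothesis pn : forall x y, pos x -> ~~ pos y -> e x y = 0.
Hypothesis h_gt0 : forall x, x != k -> (0 < h x)%N -> e x k = - (h x)%:R.
Hypothesis h_eq0 : forall x, x != k -> h x = 0%N -> 0 <= e x k /\ b x = pos x.
Hypothesis e_gt0 : forall x, x != k -> 0 < e x k -> ~~ pos x.
Hypothesis became_pos : forall x y, x != y -> x != k -> ~~ pos x -> b x -> ~~ pos y -> e x y = 0.
Hypothesis stayed_neg : forall i j, i != k -> j != k -> ~~ pos i -> ~~ b i -> (0 < h i)%N ->
  0 < e j k -> (r j < r i)%N.

(** The values of E on the new vectors c_x + h_x c_k and - c_k, expanded with E(c_k, c_k) = 1. *)
Definition mutated_euler x y : int :=
  if x == k then - (e k y + (h y)%:R)
  else if y == k then - (e x k + (h x)%:R)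
  else e x y + (h y)%:R * e x k + (h x)%:R * e k y + (h x)%:R * (h y)%:R.

(* Reorder so that negative vectors that stay negative come first, then those that
   become positive, then the positive ones.  All [j] with [0 < e j k] then precede all
   [i] with [0 < h i], and [k] is moved in between. *)
Let N := (\max_x r x).+1.
Let lvl x := (if pos x then 2 else if b x then 1 else 0)%N.
Let r2 x := (lvl x * N + r x)%N.
Let low x := [exists j, [&& j != k, 0 < e j k & (r2 x <= r2 j)%N]].
Let r3 x := if x == k then (3 * N)%N else if low x then r2 x else (3 * N + 1 + r2 x)%N.

Let rN x : (r x < N)%N.
Proof. by rewrite ltnS; apply: leq_bigmax. Qed.

Let r2_lt x : (r2 x < 3 * N)%N.
Proof. by rewrite /r2 /lvl; have := rN x; case: (pos x); case: (b x); lia. Qed.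

(** The level cannot drop along a nonzero [e x y]: [pn] forbids leaving level 2 and [became_pos]
    forbids going from level 1 to a negative vector. *)
Let r2_mono x y : x != k \/ pos x -> x != y -> e x y != 0 -> (r2 x < r2 y)%N.
Proof.
move=> xk xy exy; have lt := ord xy exy.
suff : (lvl x <= lvl y)%N by rewrite /r2; nia.
rewrite /lvl; case: (boolP (pos y)) => py; first by case: (pos x); case: (b x).
case: (boolP (pos x)) => px; first by move: exy; rewrite pn // eqxx.
have xnk : x != k by case: xk => // px'; rewrite px' in px.
by case: (boolP (b x)) => // bx; move: exy; rewrite became_pos // eqxx.
Qed.

Let mono x y : x != y -> e x y != 0 -> (r2 x < r2 y)%N.
Proof.
by apply: r2_mono; case: (eqVneq x k) => [->|]; [right | left].
Qed.

(** Any [j] with 0 < [e j k] is negative and unchanged, hence on level 0. So it precedes [i] if [i]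
    is on a higher level, and by [stayed_neg] otherwise. *)
Let changed_high i : i != k -> (0 < h i)%N -> ~~ low i.
Proof.
move=> ik hi; apply/existsP => -[j /and3P[jk ej]].
have nj := e_gt0 jk ej.
have hj : h j = 0%N by case: (posnP (h j)) => // hj; move: ej; rewrite h_gt0 //; lia.
have [_ bj] := h_eq0 jk hj.
have lj : r2 j = r j by rewrite /r2 /lvl bj (negPf nj) mul0n.
suff : (r j < r2 i)%N by rewrite lj; lia.
rewrite /r2 /lvl; have := rN j.
case: (boolP (pos i)) => pi; first by lia.
case: (boolP (b i)) => bi; first by lia.
by have := stayed_neg ik jk pi bi hi ej; lia.
Qed.

Let low_mono x y : (r2 x < r2 y)%N -> x != k -> y != k -> (r3 x < r3 y)%N.
Proof.
rewrite /r3 => lt /negPf-> /negPf->; have := r2_lt x.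
case: (boolP (low y)) => [ly|_]; last by case: (low x); lia.
suff -> : low x by [].
case/existsP: ly => j /and3P[jk ej le]; apply/existsP; exists j.
by rewrite jk ej /=; lia.
Qed.

Let e_gt0_low j : j != k -> 0 < e j k -> low j.
Proof. by move=> jk ej; apply/existsP; exists j; rewrite jk ej /=. Qed.

Lemma mutated_order : exists r' : 'I_n -> nat,
  forall x y, x != y -> mutated_euler x y != 0 -> (r' x < r' y)%N.
Proof.
have unchanged x : x != k -> h x = 0%N -> e x k != 0 -> low x.
  move=> xk hx ex; apply: e_gt0_low => //; have [le _] := h_eq0 xk hx.
  by rewrite lt_def ex.
exists r3 => x y; rewrite /mutated_euler.
have [->|xk] := eqVneq x k.
  rewrite eq_sym => yk; rewrite oppr_eq0 => ne.
  rewrite /r3 eqxx (negPf yk).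
  suff -> : low y = false by lia.
  apply/negbTE; have [hy|hy] := posnP (h y); last exact: changed_high.
  rewrite hy addr0 in ne; apply/existsP => -[j /and3P[jk ej le]].
  have lt1 : (r2 k < r2 y)%N by apply: mono => //; rewrite eq_sym.
  have lt2 : (r2 j < r2 k)%N by apply: mono => //; apply/eqP; lia.
  by lia.
have [->|yk] := eqVneq y k.
  move=> _ ne; rewrite /r3 eqxx (negPf xk).
  have [hx|hx] := posnP (h x); last by move: ne; rewrite h_gt0 // addNr oppr0 eqxx.
  rewrite hx addr0 oppr_eq0 in ne.
  by rewrite unchanged //; apply: r2_lt.
move=> xy ne.
have [exy|exy] := eqVneq (e x y) 0; last by apply: low_mono => //; apply: mono.
(* With [e x y] = 0 and h x = 0, only h y * e x k remains, so [x] is low and [y] is not. If h x > 0,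
   then e x k = - h x, the terms in h y cancel and h x * e k y remains, so [k] lies between [x] and
   [y] for [r2]. *)
have [hx|hx] := posnP (h x).
  rewrite exy hx !mul0r !addr0 add0r mulf_eq0 negb_or in ne.
  case/andP: ne => hy exk.
  have hy0 : (0 < h y)%N by case: (posnP (h y)) hy => // ->.
  have := r2_lt x; rewrite /r3 (negPf xk) (negPf yk) unchanged //.
  by rewrite (negPf (changed_high yk hy0)); lia.
have exk := h_gt0 xk hx.
have eky : e k y != 0.
  by apply: contra ne => /eqP->; rewrite exy exk; apply/eqP; ring.
apply: low_mono => //; apply: (@ltn_trans (r2 k)); apply: mono => //.
  by rewrite exk; lia.
by rewrite eq_sym.
Qed.

End MutatedOrder.

(** * Mutation at a positive vector *)

Section FrameMutation.
Variables (n : nat) (Q : quiver n) (c : 'I_n -> 'cV[int]_n) (pos : 'I_n -> bool).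
Variables (X : 'I_n -> cplx Q) (r : 'I_n -> nat).
Hypothesis F : frame c pos X r.
Local Notation A := (arrow Q).
Local Notation e i j := (form (euler Q) (c i) (c j)).
Local Notation H m i j := (hdim (X i) (X j) m).
Variable k : 'I_n.
Hypothesis pk : pos k.

Section Mutated.
Variables (i : 'I_n) (Y : cplx Q) (h : nat) (b : bool).
Hypothesis ik : i != k.
Hypothesis mY : mutated c pos X k i Y h b.

Let ki : k != i. Proof. by rewrite eq_sym. Qed.

(* H^1(X_i, X_k) and H^2(X_i, X_k) are not both nonzero, since Y is a stalk. *)
Lemma mutated_high_acyclic m : (0 < h)%N -> 2 <= m -> acyclic_at m (X i) (X k).
Proof.
move=> h0 m2; case: (boolP (pos i)) => pi.
  by apply: (acyclic_stalk (frame_stalk F i) (frame_stalk F k)); rewrite pi pk /=; apply/eqP; lia.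
have [->|m3] := eqVneq m 2; last first.
  by apply: (acyclic_stalk (frame_stalk F i) (frame_stalk F k));
    rewrite (negPf pi) pk /=; apply/eqP; lia.
case: mY => phi [ext aY [bY sY] cY]; case: h h0 cY => // h' _ cY.
move=> conn.
have a2 : acyclic_at 2 Y (X k).
  (* The connecting clause is applied to Y itself: H^2(Y, Y) = 0 because Y is a stalk. *)
  rewrite -[2]/(1 + 1); apply: conn; first exact: aY.
    by apply: (ext_acyclic_pre ext); [apply: (frame_pn_acyclic F) | apply: (frame_rigid F)].
  by apply: (acyclic_stalk sY sY); rewrite subrr.
apply: (ext_acyclic_pre' ext) a2; exact: (frame_rigid F).
Qed.

(** All cohomology from Y to X_k vanishes, so 0 = E(c_i + h c_k, c_k) = E(c_i, c_k) + h. *)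
Lemma mutated_form_gt0 : (0 < h)%N -> e i k = - h%:R.
Proof.
move=> h0; have [phi [ext aY [bY sY] cY hY]] := mY.
have a m : acyclic_at m Y (X k).
  have [m1|m1] := leP m 1; first exact: aY.
  apply: (ext_acyclic_pre ext); first by apply: (frame_rigid F); apply/eqP; lia.
  by apply: mutated_high_acyclic => //; lia.
have := euler_formula sY (frame_stalk F k).
rewrite !(acyclic_hdim _ _ _).1 // subrr mulr0 cY (frame_cls F).
rewrite formDl -scaler_nat formZl (frame_norm F); lia.
Qed.

Lemma mutated_form_eq0 : h = 0%N -> acyclic_at 1 (X i) (X k).
Proof.
by case: mY => phi [_ aY _ _]; move=> + h0; rewrite h0 => -[<- _]; apply: aY.
Qed.

Lemma mutated_form_ge0 : h = 0%N -> 0 <= e i k.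
Proof.
move=> /mutated_form_eq0/acyclic_hdim h1; case: (boolP (pos i)) => pi.
  by rewrite (frame_same_neq F) ?pi ?pk // h1.
by rewrite (frame_np F) // h1; lia.
Qed.

(** The number of copies attached is the coefficient of seed mutation, as B_{k,i} = E(c_k, c_i) -
    E(c_i, c_k). If h > 0 the first term vanishes by [frame_antisym]; if h = 0 the first is
    nonpositive and the second nonnegative. *)
Lemma mutated_coef : h%:R = pos_part (e k i - e i k).
Proof.
rewrite /pos_part; have [h0|h0] := posnP h; last first.
  have e1 := mutated_form_gt0 h0.
  rewrite (frame_antisym F ik); last by rewrite e1; lia.
  by rewrite e1 maxEle; case: ifP; lia.
have := mutated_form_ge0 h0; rewrite h0 => ge.
suff : e k i <= 0 by rewrite maxEle; case: ifP; lia.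
case: (boolP (pos i)) => pi; last by rewrite (frame_pn F).
by rewrite (frame_same_neq F) ?pi ?pk //; lia.
Qed.

Lemma mutated_hom_l W m :
  acyclic_at m (X k) W -> acyclic_at m (X i) W -> acyclic_at m Y W.
Proof. by case: mY => phi [ext _ _ _ _]; apply: (ext_acyclic_pre ext). Qed.

Lemma mutated_hom_r W m :
  acyclic_at m W (X k) -> acyclic_at m W (X i) -> acyclic_at m W Y.
Proof. by case: mY => phi [ext _ _ _ _]; apply: (ext_acyclic_post ext). Qed.

End Mutated.

Lemma frame_mutation_pos : exists pos',
  framed Q (fun i => if i == k then - c k
                     else c i + pos_part (e k i - e i k) *: c k) pos'.
Proof.
have [t tP] : exists t : 'I_n -> (cplx Q * nat * bool)%type, forall i, i != k ->
    mutated c pos X k i (t i).1.1 (t i).1.2 (t i).2.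
  apply: (fin_all_exists (P := fun i t => i != k ->
    mutated c pos X k i t.1.1 t.1.2 t.2)) => i.
  (* The value at [k] is a placeholder; there the new object is the shift of X_k. *)
  have [->|ik] := eqVneq i k; first by exists (X k, 0%N, true).
  by have [t tP] := mutated_exists F pk ik; exists t.
pose Y i := (t i).1.1; pose h i := (t i).1.2; pose b i := (t i).2.
have mut i (ik : i != k) : mutated c pos X k i (Y i) (h i) (b i) := tP i ik.
pose c' i := if i == k then - c k else c i + pos_part (e k i - e i k) *: c k.
have c'E i : i != k -> c' i = c i + (h i)%:R *: c k.
  by move=> ik; rewrite /c' (negPf ik) (mutated_coef ik (mut i ik)).
have c'k : c' k = - c k by rewrite /c' eqxx.
have gt0 i (ik : i != k) := mutated_form_gt0 ik (mut i ik).
have ge0 i (ik : i != k) := mutated_form_ge0 ik (mut i ik).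
have eqb i : i != k -> h i = 0%N -> Y i = X i /\ b i = pos i.
  by move=> ik hi; case: (mut i ik) => phi [_ _ _ _]; rewrite hi.
have e_gt0 i : i != k -> 0 < e i k -> ~~ pos i.
  by move=> ik; apply: contraL => pi; rewrite (frame_same_neq F) ?pi ?pk //; lia.
have sY i (ik : i != k) : stalk (stalk_deg (b i)) (Y i).
  by case: (mut i ik) => phi [_ _ [_ ?] _ _].
have bY i (ik : i != k) : brick (Y i).
  by case: (mut i ik) => phi [_ _ [? _] _ _].
(* The new object at [x] is in degree 0 and X_y in degree -1, so H^1 between them is zero. This
   passes back to X_x because H^0(X_k, X_y) = 0. *)
have became_pos x y : x != y -> x != k -> ~~ pos x -> b x -> ~~ pos y -> e x y = 0.
  move=> xy xk px bx py; have [phi [ext _ _ _ _]] := mut x xk.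
  suff : acyclic_at 1 (X x) (X y).
    by move/acyclic_hdim; rewrite (frame_same_neq F) ?(negPf px) ?(negPf py) // => ->; lia.
  apply: (ext_acyclic_pre' ext); first exact: (frame_pn_acyclic F).
  by apply: (acyclic_stalk (sY x xk) (frame_stalk F y)); rewrite bx (negPf py) /=; apply/eqP; lia.
(* If [e j i] were zero, so would be H^1(X_j, X_i). As H^1(X_j, X_k) = 0, and H^2(X_j, Y_i) = 0
   between stalks in degree -1, the connecting clause would give H^2(X_j, X_k) = 0, against 0 <
   [e j k]. *)
have stayed_neg i j : i != k -> j != k -> ~~ pos i -> ~~ b i -> (0 < h i)%N ->
    0 < e j k -> (r j < r i)%N.
  move=> ik jk pi bi hi ej; have pj := e_gt0 j jk ej.
  have ij : j != i.
    by apply: contraTneq ej => ->; rewrite gt0 //; lia.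
  have hj : h j = 0%N by case: (posnP (h j)) => // hj; move: ej; rewrite gt0 //; lia.
  apply: (frame_order F) => //; apply/eqP => eji.
  have a1 : acyclic_at 1 (X j) (X k) := mutated_form_eq0 (mut j jk) hj.
  have a1' : acyclic_at 1 (X j) (X i).
    apply/acyclic_hdim; move: eji.
    by rewrite (frame_same_neq F) ?(negPf pi) ?(negPf pj) //; lia.
  have a2 : acyclic_at 2 (X j) (X k).
    have [phi [_ _ _ _]] := mut i ik; case: (h i) hi => // h' _ conn.
    apply: (conn (X j) 1) => //.
    apply: (acyclic_stalk (frame_stalk F j) (sY i ik)).
      by rewrite (negPf pj) (negPf bi).
    by rewrite (negPf pj) (negPf bi).
  by move: ej; rewrite (frame_np F) // ((acyclic_hdim _ _ _).1 a2) ; lia.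
have [r' r'P] := mutated_order pk (frame_order F) (frame_pn F) gt0
  (fun x xk hx => conj (ge0 x xk hx) (eqb x xk hx).2) e_gt0 became_pos stayed_neg.
have formE x y : x != y -> form (euler Q) (c' x) (c' y) =
    mutated_euler k (fun i j => e i j) h x y.
  rewrite /mutated_euler; have [->|xk] := eqVneq x k.
    rewrite eq_sym => yk; rewrite c'k c'E // formNl formDr formZr (frame_norm F); ring.
  have [->|yk] := eqVneq y k => xy.
    rewrite c'k c'E // formNr formDl formZl (frame_norm F); ring.
  rewrite !c'E // !formDl !formDr !formZl !formZr (frame_norm F); ring.
exists (fun i => if i == k then false else b i).
exists (fun i => if i == k then shift (X k) else Y i), r'; split.
- move=> i; have [_|ik] := eqVneq i k; last exact: sY.
  by move=> x /=; rewrite (frame_stalk F) pk.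
- move=> i; have [_|ik] := eqVneq i k; first by rewrite cls_shift (frame_cls F).
  have [phi [_ _ _ -> _]] := mut i ik.
  by rewrite -(mutated_coef ik (mut i ik)) scaler_nat.
- move=> i; have [_|ik] := eqVneq i k; last exact: bY.
  exact/brick_shift/(frame_brick F).
- move=> i j m ij m0.
  have aX x m1 : x != k -> m1 <= 0 -> acyclic_at m1 (X k) (X x).
    by move=> xk; apply: (frame_hom F); rewrite eq_sym.
  case: (eqVneq i k) ij => [->|ik] ij.
    have jk : j != k by rewrite eq_sym.
    rewrite (negPf jk); apply: acyclic_shiftl; apply: (mutated_hom_r (mut j jk)).
      by apply: (frame_rigid F); apply/eqP; lia.
    by apply: aX => //; lia.
  case: (eqVneq j k) ij => [->|jk] ij.
    (* The shift moves degree m to m + 1 <= 1; degree 1 is the one that the universal extension has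
       killed. *)
    apply: acyclic_shiftr; have [phi [_ aY _ _ _]] := mut i ik.
    by apply: aY; lia.
  apply: (mutated_hom_r (mut j jk)).
    by have [phi [_ aY _ _ _]] := mut i ik; apply: aY; lia.
  apply: (mutated_hom_l (mut i ik)); first exact: aX.
  exact: (frame_hom F).
- move=> i; have [_|ik] := eqVneq i k; first by rewrite formNl formNr opprK (frame_norm F).
  rewrite -(mutated_coef ik (mut i ik)) formDl !formDr !formZl !formZr !(frame_norm F).
  have [->|hi] := posnP (h i); first ring.
  (* Here E(c_i, c_k) = - h and E(c_k, c_i) = 0, so the new norm is 1 - h^2 + h^2. *)
  rewrite (frame_antisym F ik) ?gt0 //; first ring.
  by apply/eqP; lia.
- by move=> i j ij; rewrite -/(c' i) -/(c' j) formE //; apply: r'P.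
Qed.

End FrameMutation.

(** * Negative vectors by duality, and signs *)

Section FrameOpposite.
Variables (n : nat) (Q : quiver n).

Lemma cls_opc (X : cplx Q) : cls (opc X) = - cls X.
Proof.
apply/matrixP => i j; rewrite !mxE -sumrN; apply: eq_bigr => x _ /=.
by rewrite exprzDr // sign_exprzN mulN1r.
Qed.

Lemma euler_opq : euler (opq Q) = (euler Q)^T.
Proof.
apply/matrixP => i j; rewrite !mxE eq_sym; congr (_ - _%:R).
by apply: eq_card => a; rewrite !inE andbC.
Qed.

(** Duality reverses arrows, signs and the order, and so turns a mutation at a negative vector into
    one at a positive vector. *)
Lemma framed_opp c pos : framed Q c pos ->
  framed (opq Q) (fun i => - c i) (fun i => ~~ pos i).
Proof.
case=> X [r F].
have rb i : (r i <= \max_j r j)%N by apply: leq_bigmax.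
exists (fun i => opc (X i)), (fun i => \max_j r j - r i)%N; split.
- by move=> i x /=; rewrite (frame_stalk F); case: (pos i).
- by move=> i; rewrite cls_opc (frame_cls F).
- by move=> i; apply: brick_op; apply: (frame_brick F).
- by move=> i j m ij m0; apply: acyclic_op; apply: (frame_hom F); rewrite // eq_sym.
- by move=> i; rewrite euler_opq formNl formNr opprK form_tr (frame_norm F).
- move=> i j ij; rewrite euler_opq formNl formNr opprK form_tr => ne.
  rewrite eq_sym in ij; have := frame_order F _ _ ij ne; have := rb i; lia.
Qed.

End FrameOpposite.

Lemma opqK n (Q : quiver n) : opq (opq Q) = Q.
Proof. by case: Q. Qed.

Lemma framed_ext n (Q : quiver n) c c' pos : c =1 c' -> framed Q c pos -> framed Q c' pos.
Proof.
move=> cc [X [r F]]; exists X, r; split.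
- exact: (frame_stalk F).
- by move=> i; rewrite -cc (frame_cls F).
- exact: (frame_brick F).
- exact: (frame_hom F).
- by move=> i; rewrite -cc (frame_norm F).
- by move=> i j; rewrite -!cc; apply: (frame_order F).
Qed.

Lemma frame_mutation n (Q : quiver n) c pos (k : 'I_n) : framed Q c pos ->
  exists pos', framed Q (fun i => if i == k then - c k else c i +
     pos_part ((if pos k then 1 else -1)
               * (form (euler Q) (c k) (c i) - form (euler Q) (c i) (c k))) *: c k) pos'.
Proof.
move=> fr; case: (boolP (pos k)) => pk.
  case: fr => X [r F]; have [pos' fr'] := frame_mutation_pos F pk; exists pos'.
  by apply: framed_ext fr' => i; rewrite mul1r.
have [X [r F]] := framed_opp fr.
have [pos' /framed_opp] := frame_mutation_pos F pk; rewrite opqK => fr'.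
eexists; apply: framed_ext fr' => i /=; case: eqP => _; first by rewrite opprK.
rewrite euler_opq !form_tr !formNl !formNr !opprK opprD opprK scalerN opprK mulN1r.
by rewrite opprB.
Qed.

Section FrameSigns.
Variables (n : nat) (Q : quiver n) (c : 'I_n -> 'cV[int]_n) (pos : 'I_n -> bool).
Hypothesis fr : framed Q c pos.
Local Notation e i j := (form (euler Q) (c i) (c j)).

Lemma framed_vec_sgn k : vec_sgn (c k) = if pos k then 1 else -1.
Proof.
case: fr => X [r F].
have cE i : c k i 0 = (if pos k then 1 else -1) * (\sum_(x : X k | vtx x == i) 1).
  rewrite -(frame_cls F) mxE mulr_sumr; apply: eq_bigr => x _.
  by rewrite (frame_stalk F) mulr1; case: (pos k).
have ge0 i : 0 <= \sum_(x : X k | vtx x == i) 1 :> int by apply: sumr_ge0.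
rewrite /vec_sgn; case: (boolP (pos k)) cE => pk cE.
  have -> : nonneg_vec (c k) by apply/forallP => i; rewrite cE mul1r.
  by [].
have np : nonpos_vec (c k).
  by apply/forallP => i; rewrite cE mulN1r oppr_le0.
(* [vec_sgn] tests nonnegativity first, so the zero vector has to be excluded; the norm 1 does
   this. *)
rewrite np ifN //; apply/negP => /forallP nn.
have c0 : c k = 0.
  apply/matrixP => i j; rewrite ord1 mxE; apply/eqP; rewrite eq_le nn andbT.
  by move/forallP: np; apply.
by have := frame_norm F k; rewrite c0 /form mulmx0 mxE.
Qed.

Lemma framed_norm i : e i i = 1.
Proof. by case: fr => X [r F]; apply: (frame_norm F). Qed.

Lemma framed_antisym i j : i != j -> e i j = 0 \/ e j i = 0.
Proof.
case: fr => X [r F] ij; have [|/(frame_antisym F ij)] := eqVneq (e i j) 0; first by left.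
by right.
Qed.

Lemma framed_pos_le0 k i : i != k -> pos k -> e k i <= 0.
Proof.
case: fr => X [r F] ik pk; case: (boolP (pos i)) => pi; last by rewrite (frame_pn F).
by rewrite (frame_same_neq F) ?pi ?pk 1?eq_sym //; lia.
Qed.

Lemma framed_neg_le0 k i : i != k -> ~~ pos k -> e i k <= 0.
Proof.
case: fr => X [r F] ik pk; case: (boolP (pos i)) => pi; first by rewrite (frame_pn F).
by rewrite (frame_same_neq F) ?(negPf pi) ?(negPf pk) //; lia.
Qed.

End FrameSigns.

(** * Reflections preserve real roots *)

Section RealRoots.
Variables (n : nat) (A : 'M[int]_n).
Hypothesis symA : A^T = A.
Hypothesis diagA : forall i, A i i = 2.
Implicit Types u v w : 'cV[int]_n.

Lemma form_sym u v : form A u v = form A v u.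
Proof. by rewrite -{1}symA form_tr. Qed.

Lemma form_simple_root i v : form A (simple_root i) v = (A *m v) i 0.
Proof.
have srT j : (simple_root i)^T 0 j = (j == i)%:R by rewrite !mxE andbT.
rewrite /form -mulmxA mxE (bigD1 i) //= srT eqxx mul1r big1 ?addr0 // => j ne.
by rewrite srT (negPf ne) mul0r.
Qed.

Lemma simple_reflectionE i v :
  simple_reflection A i v = v - form A (simple_root i) v *: simple_root i.
Proof. by rewrite /simple_reflection form_simple_root. Qed.

Lemma form_simple_simple i j : form A (simple_root i) (simple_root j) = A i j.
Proof.
have sr l : simple_root j l 0 = (l == j)%:R by rewrite !mxE andbT.
rewrite form_simple_root mxE (bigD1 j) //= sr eqxx mulr1 big1 ?addr0 // => l ne.
by rewrite sr (negPf ne) mulr0.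
Qed.

(** Induction on the root [b], through the conjugation formula s_{s_i b} = s_i s_b s_i. *)
Lemma real_root_reflect b v : real_root A b -> real_root A v -> real_root A (reflection A b v).
Proof.
move=> rb; elim: rb v => [i|i {}b _ IH] v rv.
  by rewrite /reflection -simple_reflectionE; apply: real_root_reflection.
have -> : reflection A (simple_reflection A i b) v =
    simple_reflection A i (reflection A b (simple_reflection A i v)).
  rewrite /reflection !simple_reflectionE !(formDl, formDr, formNl, formNr, formZl, formZr).
  rewrite form_simple_simple diagA (form_sym b (simple_root i)).
  by apply/matrixP => x y; rewrite !mxE; ring.
exact/real_root_reflection/IH/real_root_reflection.
Qed.

End RealRoots.

(** * The seed pattern *)

Section InitialSeed.
Variables (n : nat) (B : 'M[int]_n).
Hypothesis skewB : skew_symmetric B.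

Definition mult (ij : ('I_n * 'I_n)%type) := `|pos_part (- B ij.1 ij.2)|%N.

Definition quiver_of : quiver n :=
  @Quiver n {ij : ('I_n * 'I_n)%type & 'I_(mult ij)} (fun a => (tag a).1) (fun a => (tag a).2).

Lemma card_quiver_of i j :
  #|[pred a : arrow quiver_of | (src a == i) && (tgt a == j)]| = mult (i, j).
Proof.
rewrite -sum1_card big_mkcond /=.
rewrite -(@sig_big_dep _ _ _ _ (fun ij => 'I_(mult ij)) xpredT (fun _ => xpredT)
  (fun ij _ => if (ij.1 == i) && (ij.2 == j) then 1 else 0)%N) /=.
rewrite (bigD1 (i, j)) //= !eqxx /= sum1_card card_ord big1 ?addn0 // => -[i' j'] ne.
rewrite big1 // => _ _; case: ifP => // /andP[/= /eqP e1 /eqP e2].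
by rewrite e1 e2 eqxx in ne.
Qed.

Lemma skewE i j : B j i = - B i j.
Proof. by have /matrixP/(_ i j) := skewB; rewrite !mxE. Qed.

Lemma euler_quiver_of i j : euler quiver_of i j = (i == j)%:R - pos_part (- B i j).
Proof.
rewrite mxE card_quiver_of /mult /pos_part /=; congr (_ - _).
by rewrite maxEle; case: ifP; lia.
Qed.

Lemma skew_diag i : B i i = 0.
Proof. by have := skewE i i; lia. Qed.

Lemma gen_cartan_euler : gen_cartan B = euler quiver_of + (euler quiver_of)^T.
Proof.
apply/matrixP => i j; rewrite [LHS]mxE [RHS]mxE [in X in _ + X]mxE !euler_quiver_of skewE.
rewrite /pos_part !maxEle eq_sym; case: eqVneq => [->|_]; first by rewrite skew_diag.
by case: ifP; case: ifP; lia.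
Qed.

Lemma skew_euler : B = euler quiver_of - (euler quiver_of)^T.
Proof.
apply/matrixP => i j; rewrite [RHS]mxE [in X in _ + X]mxE [in X in _ + X]mxE.
rewrite !euler_quiver_of skewE eq_sym /pos_part !maxEle.
by case: ifP; case: ifP; lia.
Qed.

Hypothesis acyclicB : acyclic_diagram B.

Definition simple_shape (i : 'I_n) : shape n := @Shape n unit (fun _ => i) (fun _ => 0).

Lemma simple_homog i : @homog n quiver_of (simple_shape i) (simple_shape i) 1 0.
Proof. exact: homog0. Qed.

Definition simple_cplx i : cplx quiver_of := Cplx (@simple_homog i) (mcomp0l _ _).

(** The number of vertices from which [i] can be reached serves as the initial rank; by acyclicity
    it grows strictly along arrows. *)
Lemma connect_lt (i j : 'I_n) : diagram B i j ->
  (#|[pred x | connect (diagram B) x i]| < #|[pred x | connect (diagram B) x j]|)%N.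
Proof.
move=> ij; apply: proper_card; apply/properP; split.
  by apply/subsetP => x; rewrite !inE => xi; apply: connect_trans xi (connect1 ij).
exists j; rewrite !inE ?connect0 //; apply/negP => /connectP[p pp e].
have : path.cycle (diagram B) (j :: p) by rewrite /= rcons_path pp -e.
by move/acyclicB.
Qed.

Lemma initial_frame : framed quiver_of (@simple_root n) (fun _ => true).
Proof.
have st i : stalk 0 (simple_cplx i) by [].
exists simple_cplx, (fun i => #|[pred x | connect (diagram B) x i]|).
have fE i j (f : mor (arrow quiver_of) (simple_cplx i) (simple_cplx j)) :
    homog 0 f -> f = (if i == j then f (tt, tt, None) else 0) *: lift0 _ (fun _ _ => 1).
  move=> h; apply/ffunP => -[[[] []] [a|]]; rewrite !ffunE /=.
    by rewrite scaler0; apply/eqP/negPn/negP => /h/andP[_].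
  rewrite /GRing.scale /= mulr1; case: eqP => // ne.
  by apply/eqP/negPn/negP => /h/andP[/eqP].
split.
- by [].
- move=> i; apply/matrixP => l j; rewrite !mxE big_mkcond /=.
  rewrite (bigD1 tt) //= big1 ?addr0 => [|[]//].
  by rewrite ord1 eqxx andbT eq_sym; case: (l == i).
- move=> i; split.
    case=> h hh e.
    have := congr1 (fun f : mor _ _ _ => f (tt, tt, None)) e.
    by rewrite (homog_stalk (st i) (st i) hh) // dif0 !ffunE /= => /eqP.
  move=> f [/fE e _]; move: e; rewrite eqxx.
  have -> : lift0 (arrow quiver_of) (fun _ _ : simple_cplx i => 1) = idm _ _.
    by apply/ffunP => -[[[] []] o]; rewrite !ffunE.
  have [->|/F2_neq0-> ->] := eqVneq (f (tt, tt, None)) 0.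
    by rewrite scale0r => ->; left; apply: bounds0.
  by rewrite scale1r addff; right; apply: bounds0.
- move=> i j m ij m0.
  have [->|mn0] := eqVneq m 0; last first.
    by apply: (acyclic_stalk (st i) (st j)); apply/eqP; move/eqP: mn0; lia.
  by move=> f [/fE e _]; rewrite e (negPf ij) scale0r; apply: bounds0.
- move=> i; rewrite form_simple_simple euler_quiver_of eqxx skew_diag oppr0.
  by rewrite addr0.
- move=> i j ij; rewrite form_simple_simple euler_quiver_of (negPf ij) sub0r oppr_eq0 => ne.
  apply: connect_lt; rewrite /diagram skewE; move: ne; rewrite /pos_part maxEle.
  by case: ifP; rewrite ?eqxx //; lia.
Qed.

End InitialSeed.

(** Edges can be followed both ways, so [P] at any vertex is equivalent to [P] at the root, and the
    induction may start at any [t0]. *)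
Lemma tree_ind n (P : tree n -> Prop) t0 :
  (forall k t t', tree_edge k t t' -> P t -> P t') -> P t0 -> forall t, P t.
Proof.
move=> step P0.
have root_iff w (sw : sorted (fun i j => i != j) w) :
    P (exist _ w sw) <-> P (exist _ [::] isT).
  elim: w sw => [|a w IH] sw; first by rewrite (bool_irrelevance sw isT).
  have sw' : sorted (fun i j => i != j) w by apply: path_sorted sw.
  rewrite -(IH sw'); split; apply: (step a); [by right | by left].
by case=> w sw; apply/root_iff; case: t0 P0 => w0 sw0 /root_iff.
Qed.

(** * The invariant of the pattern and the three claims *)

Section SeedInvariant.
Variables (n : nat) (B0 : 'M[int]_n).
Hypotheses (skewB : skew_symmetric B0).
Local Notation E := (euler (quiver_of B0)).
Local Notation A0 := (gen_cartan B0).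

Definition seed_ok (s : preseed n) := exists pos,
  [/\ framed (quiver_of B0) s.1 pos, forall i, real_root A0 (s.1 i)
    & forall i j, s.2 i j = form E (s.1 i) (s.1 j) - form E (s.1 j) (s.1 i)].

Lemma form_cartan u v : form A0 u v = form E u v + form E v u.
Proof.
rewrite (gen_cartan_euler skewB) -[form E v u]form_tr.
by rewrite /form mulmxDr mulmxDl mxE.
Qed.

Lemma cartan_sym : A0^T = A0.
Proof. by rewrite (gen_cartan_euler skewB) linearD /= trmxK addrC. Qed.

Lemma cartan_diag i : A0 i i = 2.
Proof. by rewrite mxE eqxx. Qed.

Section Seed.
Variables (s : preseed n) (pos : 'I_n -> bool) (k : 'I_n).
Hypothesis fr : framed (quiver_of B0) s.1 pos.
Hypothesis BE : forall i j, s.2 i j = form E (s.1 i) (s.1 j) - form E (s.1 j) (s.1 i).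
Local Notation c := (s.1).
Local Notation B := (s.2).
Local Notation eps := (vec_sgn (c k)).
Local Notation At := (gram A0 c).

Lemma gramE i j : At i j = form E (c i) (c j) + form E (c j) (c i).
Proof. by rewrite mxE form_cartan. Qed.

Lemma gram_abs i j : i != j -> `|At i j| = `|B i j|.
Proof.
by move=> ij; rewrite gramE BE; case: (framed_antisym fr ij) => ->;
  rewrite ?addr0 ?add0r ?subr0 ?sub0r ?normrN.
Qed.

Lemma eps_sq : eps * eps = 1.
Proof. by rewrite (framed_vec_sgn fr); case: (pos k). Qed.

(** One of E(c_k, c_i) and E(c_i, c_k) is zero. For positive c_k the first is nonpositive, so 0 <
    B_{k,i} forces it to vanish, and both sides equal the second; the negative case is symmetric. *)
Lemma gram_green i : i != k -> 0 < eps * B k i -> At k i = - (eps * B k i).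
Proof.
move=> ik; rewrite gramE BE (framed_vec_sgn fr); case: (boolP (pos k)) => pk.
  have := framed_pos_le0 fr ik pk; case: (framed_antisym fr ik) => ->; lia.
have := framed_neg_le0 fr ik pk; case: (framed_antisym fr ik) => ->; lia.
Qed.

Lemma mutate_seed_vecE i : (mutate_seed k s).1 i =
  if i == k then - c k else if 0 < eps * B k i then c i - At k i *: c k else c i.
Proof.
rewrite ffunE; case: eqVneq => // ik; rewrite /pos_part maxEle.
have [lt|le] := ltP 0 (eps * B k i); last by rewrite scale0r addr0.
by rewrite gram_green // scaleNr opprK.
Qed.

Lemma mutate_seed_vec_reflection i : (mutate_seed k s).1 i != c i ->
  (mutate_seed k s).1 i = reflection A0 (c k) (c i).
Proof.
rewrite mutate_seed_vecE /reflection.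
have [-> _|ik] := eqVneq i k.
  by rewrite form_cartan (framed_norm fr) scalerDl scale1r opprD addrA subrr sub0r.
by case: (boolP (0 < eps * B k i)) => [_ _|_]; [rewrite mxE | rewrite eqxx].
Qed.

Lemma mutate_seed_gram :
  gram A0 (mutate_seed k s).1 = mutate_companion eps k B At.
Proof.
have gsym i j : At i j = At j i by rewrite !gramE addrC.
have gkk : At k k = 2 by rewrite gramE (framed_norm fr).
have Bsk i j : B i j = - B j i by rewrite !BE opprB.
pose p i := eps * B k i.
(* The value 2 at [k] makes - c_k = c_k - 2 c_k an instance of the uniform formula c'_i = c_i - a_i
   c_k. *)
pose a i := if i == k then 2 else if 0 < p i then At k i else 0.
have vE i : (mutate_seed k s).1 i = c i - a i *: c k.
  rewrite mutate_seed_vecE /a; case: eqVneq => [->|_].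
    by rewrite scaler_nat mulr2n opprD addrA subrr sub0r.
  by rewrite /p; case: ifP; rewrite // scale0r subr0.
have fE i j : form A0 (c i) (c j) = At i j by rewrite mxE.
have abs_p i : i != k -> `|At k i| = `|p i|.
  move=> ik; rewrite gram_abs 1?eq_sym // /p normrM.
  by rewrite (framed_vec_sgn fr); case: (pos k); rewrite ?normrN normr1 mul1r.
have green i (ik : i != k) : 0 < p i -> At k i = - p i := gram_green ik.
have sg x : eps * Num.sg (B k x) = Num.sg (p x).
  by rewrite /p (framed_vec_sgn fr); case: (pos k); rewrite ?mul1r ?mulN1r ?sgrN.
have col i : i != k -> - At k i + 2 * (if 0 < p i then At k i else 0) = Num.sg (p i) * At k i.
  move=> ik; have [lt|lt|e0] := ltrgt0P (p i).
  - by rewrite gtr0_sg //; ring.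
  - by rewrite ltr0_sg //; ring.
  - by have := abs_p i ik; rewrite e0 normr0 => /normr0P/eqP->; rewrite sgr0; ring.
apply/matrixP => i j; rewrite [LHS]mxE !vE [RHS]mxE.
rewrite !(formDl, formDr, formNl, formNr, formZl, formZr) !fE gkk /a.
have [->|ik] := eqVneq i k; have [->|jk] := eqVneq j k => /=.
- by rewrite gkk; ring.
- by rewrite ?gkk sg -col //; ring.
- by rewrite ?gkk sg (gsym i k) -col //; ring.
rewrite (gsym i k).
have -> : B i k * B k j = - (p i * p j) by rewrite Bsk /p mulrACA eps_sq; ring.
have gi := green i ik; have gj := green j jk.
have ai := abs_p i ik; have aj := abs_p j jk.
(* Both sides vanish when [p i] and [p j] are both positive or both nonpositive. Otherwise only -
   A_{k,i} A_{k,j} survives on the left, and it equals the right side because |A_{k,i}| = |p_i| and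
   likewise for [j]. *)
suff main : - (if 0 < p i then At k i else 0) * At k j - (if 0 < p j then At k j else 0) * At k i
    + 2 * (if 0 < p i then At k i else 0) * (if 0 < p j then At k j else 0)
    = - (Num.sg (At k i * At k j) * pos_part (- (p i * p j))).
  by rewrite -main; ring.
have sgM x y : Num.sg (x * y) * `|x * y| = x * y :> int by rewrite mulr_sg_norm.
rewrite /pos_part maxEle.
have [lti|lei] := ltP 0 (p i); have [ltj|lej] := ltP 0 (p j).
- by rewrite gi // gj // ifT; [ring | nia].
- have -> : (if - (p i * p j) <= 0 then 0 else - (p i * p j)) = `|At k i * At k j|.
    by rewrite normrM ai aj (gtr0_norm lti) (ler0_norm lej); case: ifP; nia.
  by rewrite sgM; ring.
- have -> : (if - (p i * p j) <= 0 then 0 else - (p i * p j)) = `|At k i * At k j|.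
    by rewrite normrM ai aj (gtr0_norm ltj) (ler0_norm lei); case: ifP; nia.
  by rewrite sgM; ring.
- by rewrite ifT; [ring | nia].
Qed.

Lemma mutate_seed_ok : (forall i, real_root A0 (c i)) -> seed_ok (mutate_seed k s).
Proof.
move=> rr; have [pos' fr'] := frame_mutation k fr.
have vE i : (mutate_seed k s).1 i = if i == k then - c k else
    c i + pos_part (eps * (form E (c k) (c i) - form E (c i) (c k))) *: c k.
  by rewrite ffunE BE.
exists pos'; split.
- by apply: framed_ext fr' => i; rewrite vE (framed_vec_sgn fr).
- move=> i; have [e|ne] := eqVneq ((mutate_seed k s).1 i) (c i); first by rewrite e.
  rewrite mutate_seed_vec_reflection //.
  by apply: (real_root_reflect cartan_sym cartan_diag).
- move=> i j; rewrite [LHS]mxE !vE.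
  have [->|ik] := eqVneq i k; have [->|jk] := eqVneq j k => /=.
  + by rewrite BE; ring.
  + rewrite !(formDl, formDr, formNl, formNr, formZl, formZr) BE; ring.
  + rewrite !(formDl, formDr, formNl, formNr, formZl, formZr) BE; ring.
  rewrite !(formDl, formDr, formNl, formNr, formZl, formZr) !BE.
  (* What remains is an identity in B_{i,k} = x - x' and B_{k,j} = y' - y: the mutation rule with
     the sign eps agrees with the symmetric rule for either sign. *)
  set x := form E (c i) (c k); set x' := form E (c k) (c i).
  set y := form E (c j) (c k); set y' := form E (c k) (c j).
  rewrite (framed_vec_sgn fr) /pos_part !maxEle.
  by case: (pos k); rewrite ?mul1r ?mulN1r; repeat case: ifP => ?; lia || nia.
Qed.

End Seed.
End SeedInvariant.

Theorem corollary1p7 (n : nat) (B0 : 'M[int]_n)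
    (S : tree n -> preseed n) (t0 t t' : tree n) (k : 'I_n) :
  skew_symmetric B0 ->
  acyclic_diagram B0 ->
  Yseed_pattern S ->
  S t0 = (std_basis n, B0) ->
  tree_edge k t t' ->
  let A0 := gen_cartan B0 in
  let c := (S t).1 in
  let B := (S t).2 in
  let c' := (S t').1 in
  let At := gram A0 c in
  let At' := gram A0 c' in
  let eps := vec_sgn (c k) in
  [/\ c' = mutate_basis eps k B At c,
      At' = mutate_companion eps k B At
    & real_root A0 (c k) /\
      (forall i : 'I_n, c' i <> c i -> c' i = reflection A0 (c k) (c i))].
Proof.
move=> skewB acyclicB [_ mut] S0 edge A0 c B c' At At' eps.
have ok0 : seed_ok B0 (S t0).
  exists (fun _ => true); rewrite S0; split=> /=.
  - by apply: framed_ext (initial_frame skewB acyclicB) => i; rewrite ffunE.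
  - by move=> i; rewrite ffunE; apply: real_root_simple.
  - move=> i j; rewrite !ffunE !form_simple_simple.
    by rewrite {1}(skew_euler skewB) mxE [in X in _ + X]mxE [in X in _ + X]mxE.
have [pos [fr rr BE]] : seed_ok B0 (S t).
  apply: (tree_ind (P := fun t => seed_ok B0 (S t)) _ ok0) => l u u' /mut -> [pos [fr rr BE]].
  exact: (mutate_seed_ok skewB l fr BE rr).
have St' := mut _ _ _ edge.
rewrite /At' /c' St'; split.
- by apply/ffunP => i; rewrite (mutate_seed_vecE skewB k fr BE) ffunE.
- exact: (mutate_seed_gram skewB k fr BE).
- split=> // i /eqP; exact: (mutate_seed_vec_reflection skewB fr BE).
Qed.
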